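(* Let $(A,\mathfrak g,\{l_k\}_{k=1}^{+\infty},\{\rho_k\}_{k=1}^{+\infty})$ be an $L_\infty$-algebroid. Then there is a post-Lie$_\infty$ algebra structure on $A\otimes \mathfrak g$ (tensor product over the ground field) given by $$\begin{aligned} \mathfrak M_{0,q}\big((a_1\otimes x_1)\cdots (a_q\otimes x_q)\big)&=(-1)^{\sum_{i=1}^{q}(1+x_1+\cdots+x_{i-1})a_i}\,a_1\cdots a_q\otimes l_q(x_1,\ldots,x_q)\qquad(q\ge1),\\ \mathfrak M_{p,1}\big((a_1\otimes x_1)\cdots (a_p\otimes x_p)\otimes(a_{p+1}\otimes x_{p+1})\big)&=(-1)^{\sum_{i=1}^{p}(1+x_1+\cdots+x_{i-1})a_i}\,a_1\cdots a_p\,\rho_{p}(x_1,\ldots,x_p)(a_{p+1})\otimes x_{p+1}\qquad(p\ge1), \end{aligned}$$ and $\mathfrak M_{p,q}=0$ in all other cases.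
   Context: The ground field $\mathbf k$ has characteristic zero; graded means $\mathbb Z$-graded; in exponents of $-1$ a homogeneous element stands for its degree. $\mathsf S(V)$ is the graded symmetric algebra, products in it are written by juxtaposition; $\mathbb S_{(i_1,\dots,i_k)}$ is the set of $(i_1,\dots,i_k)$-shuffles; $\varepsilon(\sigma)$ is the Koszul sign: $v_1\cdots v_n=\varepsilon(\sigma)v_{\sigma(1)}\cdots v_{\sigma(n)}$ in $\mathsf S(V)$. An $L_\infty$-algebra $(\mathfrak g,\{l_k\}_{k\ge1})$ is a graded vector space with graded symmetric maps $l_k:\mathsf S^k(\mathfrak g)\to\mathfrak g$ of degree $1$ such that for all $n\ge1$: $\sum_{i=1}^{n}\sum_{\sigma\in \mathbb S_{(i,n-i)}}\varepsilon(\sigma)l_{n-i+1}(l_i(x_{\sigma(1)},\ldots,x_{\sigma(i)}),x_{\sigma(i+1)},\ldots,x_{\sigma(n)})=0$. An action of an $L_\infty$-algebra $(\mathfrak g,\{l_k\})$ on a dg commutative algebra $(A,\cdot,d)$ is a family of degree $1$ linear maps $\rho_k:\mathsf S^k(\mathfrak g)\to \mathrm{Der}(A)$, $k\ge1$ ($\mathrm{Der}(A)$ is the graded space of derivations), such that for all $n\ge1$ and homogeneous $x_1,\dots,x_n\in\mathfrak g$ $$\begin{aligned}&\sum_{i=1}^n\sum_{\sigma\in \mathbb S_{(i,n-i)}}\varepsilon(\sigma)\rho_{n-i+1}\big(l_i(x_{\sigma(1)},\ldots,x_{\sigma(i)}),x_{\sigma(i+1)},\ldots,x_{\sigma(n)}\big)\\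 &+\sum_{i=1}^{n-1}\sum_{\sigma\in \mathbb S_{(i,n-i)}}\varepsilon(\sigma)(-1)^{x_{\sigma(1)}+\cdots+x_{\sigma(i)}}\rho_i(x_{\sigma(1)},\ldots,x_{\sigma(i)})\circ \rho_{n-i}(x_{\sigma(i+1)},\ldots,x_{\sigma(n)})\\ &+d\circ \rho_n(x_1,\ldots,x_n)-(-1)^{x_1+\cdots+x_n+1}\rho_n(x_1,\ldots,x_n)\circ d=0.\end{aligned}$$ An $L_\infty$-algebroid $(A,\mathfrak g,\{l_k\},\{\rho_k\})$ over a graded commutative algebra $A$ is an $L_\infty$-algebra $(\mathfrak g,\{l_k\})$ together with an $A$-module structure on $\mathfrak g$ and an action $\{\rho_k:\mathsf S^k(\mathfrak g)\to \mathrm{Der}(A)\}_{k\ge1}$ of $\mathfrak g$ on $A$ (with $d=0$), such that for $k\ge 1$, $a\in A$, $x_1,\dots,x_{k+1}\in\mathfrak g$: $\rho_k(ax_1,\ldots,x_k)=(-1)^{a}a\rho_k(x_1,\ldots,x_k)$ and $l_{k+1}(x_1,\ldots,x_k,ax_{k+1})=\rho_k(x_1,\ldots,x_k)(a)x_{k+1}+(-1)^{a(1+x_1+\cdots+x_k)}a\,l_{k+1}(x_1,\ldots,x_{k+1})$. A post-Lie$_\infty$ algebra is a graded vector space $\mathfrak g$ with linear maps $\mathfrak M_{p,q}:\mathsf S^p(\mathfrak g)\otimes \mathsf S^q(\mathfrak g)\to\mathfrak g$ of degree $1$, $p\ge0,q\ge1$, such that for all $n\ge 0,m\ge1$ and homogeneous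 $x_1,\dots,x_{n+m}$ $$\begin{aligned}&\sum_{\substack{0\le j\le n-1,\,1\le i\le n\\ i+j\le n}}\ \sum_{\sigma\in \mathbb S_{(j,i,n-j-i)}}\varepsilon(\sigma)\mathfrak M_{n-j-i+1,m}\Big(\mathfrak M_{j,i}(x_{\sigma(1)}\cdots x_{\sigma(j)}\otimes x_{\sigma(j+1)}\cdots x_{\sigma(j+i)})x_{\sigma(j+i+1)}\cdots x_{\sigma(n)}\otimes x_{n+1}\cdots x_{n+m}\Big)\\ &+\sum_{0\le j\le n}\sum_{\sigma\in\mathbb S_{(n-j,j)}}\sum_{1\le i\le m}\sum_{\tau\in\mathbb S_{(i,m-i)}}\varepsilon(\sigma)\varepsilon(\tau)(-1)^{x_{\sigma(1)}+\cdots+x_{\sigma(n-j)}}\\ &\mathfrak M_{n-j,m-i+1}\Big(x_{\sigma(1)} \cdots x_{\sigma(n-j)}\otimes \mathfrak M_{j,i}\big(x_{\sigma(n-j+1)} \cdots x_{\sigma(n)}\otimes x_{n+\tau(1)} \cdots x_{n+\tau(i)}\big) x_{n+\tau(i+1)} \cdots x_{n+\tau(m)}\Big)=0.\end{aligned}$$ *)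

(* Defs.v *)
From HB Require Import structures.
From mathcomp Require Import all_boot all_order all_fingroup all_algebra.
From mathcomp Require Import generic_quotient ring_quotient boolp.
From mathcomp.multinomials Require Import freeg.

Set Implicit Arguments.
Unset Strict Implicit.
Unset Printing Implicit Defensive.

Import GRing.Theory.
Local Open Scope ring_scope.

Reserved Notation "a ⊗ x" (at level 40, left associativity).

(* A Z-grading of [V]: subspaces [homog i], i : int, of which [V] is the      *)
(* direct sum.                                                                *)
Record grading (k : fieldType) (V : lmodType k) := Grading {
  homog : int -> V -> Prop;
  homog0 : forall i, homog i 0;
  homogP : forall i (c : k) x y, homog i x -> homog i y -> homog i (c *: x + y);
  homog_span : forall v, exists n (d : 'I_n -> int) (c : 'I_n -> V),
    (forall i, homog (d i) (c i)) /\ v = \sum_(i < n) c i;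
  homog_direct : forall (s : seq int) (c : int -> V), uniq s ->
    (forall i, homog i (c i)) -> \sum_(i <- s) c i = 0 ->
    forall i, i \in s -> c i = 0
}.

Section TensorProduct.
Variables (k : fieldType) (U V : lmodType k).

Local Notation F := {freeg (U * V)%type / k}.

Inductive tensor_rel : F -> Prop :=
| TensorRelL c u u' v :
    tensor_rel (<< (c *: u + u', v) >> - (c *: << (u, v) >> + << (u', v) >>))
| TensorRelR c u v v' :
    tensor_rel (<< (u, c *: v + v') >> - (c *: << (u, v) >> + << (u, v') >>))
| TensorRel0 : tensor_rel 0
| TensorRelP c D E : tensor_rel D -> tensor_rel E -> tensor_rel (c *: D + E).

Definition tensor_ker (D : F) : bool := `[< tensor_rel D >].

Lemma tensor_ker_zmod : zmod_closed tensor_ker.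
Proof.
split=> [|D E /asboolP hD /asboolP hE]; first exact/asboolP/TensorRel0.
apply/asboolP; rewrite addrC -scaleN1r; exact: TensorRelP.
Qed.
HB.instance Definition _ := GRing.isZmodClosed.Build F tensor_ker tensor_ker_zmod.

Definition tensor := Quotient.quot (GRing.ZmodClosed.clone F tensor_ker _).

HB.instance Definition _ := GRing.Zmodule.on tensor.
HB.instance Definition _ := generic_quotient.Quotient.on tensor.

Let pi (D : F) : tensor := \pi_tensor%qT D.

Let pi_eq D E : (pi D = pi E) <-> tensor_rel (D - E).
Proof.
rewrite /pi; split=> [/eqP|h]; last apply/eqP.
  by rewrite -Quotient.idealrBE => /asboolP.
by rewrite -Quotient.idealrBE; apply/asboolP.
Qed.

Let piK t : pi (repr t) = t.
Proof. exact: reprK. Qed.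

Let piD D E : pi (D + E) = pi D + pi E.
Proof. exact: Quotient.pi_add. Qed.

Definition tensor_scale (c : k) (t : tensor) : tensor :=
  pi (c *: repr t).

Let piZ c D : tensor_scale c (pi D) = pi (c *: D).
Proof.
apply/pi_eq; rewrite -scalerBr -[_ *: _]addr0; apply: TensorRelP TensorRel0.
by apply/pi_eq; rewrite piK.
Qed.

Fact tensor_scaleA a b v : tensor_scale a (tensor_scale b v) = tensor_scale (a * b) v.
Proof. by rewrite -[v]piK !piZ scalerA. Qed.
Fact tensor_scale1 : left_id 1 tensor_scale.
Proof. by move=> v; rewrite -[v]piK piZ scale1r. Qed.
Fact tensor_scaleDr : right_distributive tensor_scale +%R.
Proof. by move=> a u v; rewrite -[u]piK -[v]piK -piD !piZ -piD scalerDr. Qed.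
Fact tensor_scaleDl v : {morph tensor_scale^~ v : a b / a + b}.
Proof. by move=> a b; rewrite -[v]piK !piZ -piD scalerDl. Qed.

HB.instance Definition _ := GRing.Zmodule_isLmodule.Build k tensor
  tensor_scaleA tensor_scale1 tensor_scaleDr tensor_scaleDl.

Let piZE c D : c *: pi D = pi (c *: D).
Proof. exact: piZ. Qed.

Definition tens (u : U) (v : V) : tensor := pi << (u, v) >>.

Lemma tens_linearl v : linear (tens^~ v).
Proof.
move=> c u u'; rewrite /tens piZE -piD.
by apply/pi_eq; apply: TensorRelL.
Qed.

Lemma tens_linearr u : linear (tens u).
Proof.
move=> c v v'; rewrite /tens piZE -piD.
by apply/pi_eq; apply: TensorRelR.
Qed.


HB.instance Definition _ u :=
  GRing.isLinear.Build k V tensor *:%R (tens u) (tens_linearr u).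

Lemma tensZl c u v : tens (c *: u) v = c *: tens u v.
Proof.
have t0 : tens 0 v = 0.
  apply: (@addrI _ (tens 0 v)); rewrite addr0.
  by have := tens_linearl v 1 0 0; rewrite !scale1r addr0.
by have := tens_linearl v c u 0; rewrite t0 !addr0.
Qed.

Lemma tens_sum_l n (c : 'I_n -> U) v :
  tens (\sum_(i < n) c i) v = \sum_(i < n) tens (c i) v.
Proof.
elim/big_rec2: _ => [|i y1 y2 _ <-]; last by rewrite -[c i]scale1r tens_linearl !scale1r.
by rewrite -(scale0r 0) tensZl scale0r.
Qed.

Let pi0 : pi 0 = 0.
Proof. by apply: (@addrI _ (pi 0)); rewrite -piD !addr0. Qed.

Lemma tensor_ind (P : tensor -> Prop) :
    P 0 -> (forall u v t, P t -> P (tens u v + t)) -> forall t, P t.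
Proof.
move=> P0 PD t; rewrite -[t]piK -[repr t]freeg_sumE.
elim: (dom _) => [|[u v] r IH]; first by rewrite big_nil pi0.
rewrite big_cons piD; set c := coeff _ _.
suff -> : pi << c *g (u, v) >> = tens (c *: u) v by exact: PD.
rewrite tensZl /tens piZE; congr pi.
by apply/eqP/freeg_eqP => z; rewrite coeffZ !coeffU mul1r.
Qed.

Lemma tensor_lift (W : lmodType k) (f : U -> V -> W) :
    (forall v, linear (f^~ v)) -> (forall u, linear (f u)) ->
  exists2 h : tensor -> W, linear h & forall u v, h (tens u v) = f u v.
Proof.
move=> fl fr; pose g (z : U * V) := f z.1 z.2.
have gD D E : fglift g (D + E) = fglift g D + fglift g E.
  by have := @lift_is_additive _ _ _ g D (- E); rewrite opprK => ->;
     have := @lift_is_additive _ _ _ g 0 E; rewrite sub0r => ->;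
     have := @lift_is_additive _ _ _ g 0 0; rewrite !subrr => ->; rewrite sub0r opprK.
have g0 : fglift g 0 = 0 by have := @lift_is_additive _ _ _ g 0 0; rewrite !subrr.
have gZ c D : fglift g (c *: D) = c *: fglift g D.
  rewrite -{2}[D]freeg_sumE [c *: D]/(fgscale c D) /fgscale.
  elim: (dom D) => [|z r IH]; first by rewrite !big_nil !g0 scaler0.
  by rewrite !big_cons !gD IH !liftU scalerDr scalerA.
have gN D : fglift g (- D) = - fglift g D.
  by rewrite -[- D]scaleN1r gZ scaleN1r.
have gK D : tensor_rel D -> fglift g D = 0.
  elim=> [c u u' v|c u v v'||c D1 D2 _ h1 _ h2]; last by rewrite gD gZ h1 h2 scaler0 addr0.
  - by rewrite gD gN gD gZ !liftU !scale1r /g /= fl subrr.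
  - by rewrite gD gN gD gZ !liftU !scale1r /g /= fr subrr.
  - exact: g0.
pose h t := fglift g (repr (t : tensor)).
have hpi D : h (pi D) = fglift g D.
  apply/eqP; rewrite -subr_eq0 -gN -gD; apply/eqP/gK/pi_eq; exact: piK.
exists h => [c t t'|u v]; last by rewrite hpi liftU scale1r.
rewrite -[t]piK -[t']piK piZE -piD !hpi gD gZ.
by [].
Qed.

End TensorProduct.

Notation "a ⊗ x" := (tens a x) : ring_scope.

Section GradingTheory.
Variables (k : fieldType) (V : lmodType k) (G : grading V).

Lemma homogD i x y : homog G i x -> homog G i y -> homog G i (x + y).
Proof. by move=> hx hy; rewrite -[x]scale1r; apply: homogP. Qed.

Lemma homogZ i c x : homog G i x -> homog G i (c *: x).
Proof. by move=> hx; rewrite -[_ *: _]addr0; apply: homogP (homog0 G i). Qed.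

(* Sums of homogeneous elements of degrees different from [i]. *)
Inductive off_degree (i : int) : V -> Prop :=
| OffDegree0 : off_degree i 0
| OffDegreeD j v u :
    j != i -> homog G j v -> off_degree i u -> off_degree i (v + u).

Let offD i u v : off_degree i u -> off_degree i v -> off_degree i (u + v).
Proof.
elim=> [|j w u' ji hw _ IH] hv; first by rewrite add0r.
by rewrite -addrA; apply: (OffDegreeD ji) => //; exact: IH.
Qed.

Let offZ i c u : off_degree i u -> off_degree i (c *: u).
Proof.
elim=> [|j w u' ji hw _ IH]; first by rewrite scaler0; exact: OffDegree0.
by rewrite scalerDr; apply: (OffDegreeD ji) => //; exact: homogZ.
Qed.

Let off_sum i u : off_degree i u -> exists (s : seq int) (c : int -> V),
  [/\ uniq s, i \notin s, forall j, homog G j (c j) & u = \sum_(j <- s) c j].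
Proof.
elim=> [|j w u' ji hw _ [s [c [us is_ hc ->]]]].
  by exists [::], (fun=> 0); split=> // [j|]; [exact: homog0 | rewrite big_nil].
have [js|js] := boolP (j \in s).
  exists s, (fun l => if l == j then w + c l else c l); split=> // [l|].
    by case: eqP => [->|_] //; exact: homogD.
  rewrite !(bigD1_seq j js us) /= eqxx addrA; congr (_ + _).
  by apply: eq_bigr => l /negPf ->.
exists (j :: s), (fun l => if l == j then w else c l); split=> /=.
- by rewrite js.
- by rewrite inE negb_or eq_sym ji.
- by move=> l; case: eqP => [->|_].
rewrite big_cons eqxx; congr (_ + _); apply: eq_big_seq => l ls.
by case: eqP => // lj; rewrite lj (negPf js) in ls.
Qed.

Let off_homog0 i w : homog G i w -> off_degree i w -> w = 0.
Proof.
move=> hw /off_sum [s [c [us is_ hc wE]]].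
pose c' l := if l == i then - w else c l.
have := @homog_direct _ _ G (i :: s) c' _ _ _ i (mem_head _ _).
rewrite /c' eqxx => h; apply/eqP; rewrite -oppr_eq0; apply/eqP/h => /=.
- by rewrite is_.
- by move=> l; case: eqP => [->|_] //; rewrite -scaleN1r; exact: homogZ.
rewrite big_cons eqxx; apply/eqP; rewrite addrC subr_eq0 [X in _ == X]wE; apply/eqP.
by apply: eq_big_seq => l ls; case: eqP => // li; rewrite -li ls in is_.
Qed.

Lemma homog_component i : exists c : V -> V, [/\ linear c,
  forall v, homog G i v -> c v = v &
  forall j v, homog G j v -> j != i -> c v = 0].
Proof.
pose R v w := homog G i w /\ off_degree i (v - w).
have ex v : exists w, R v w.
  have [n [d [c [hc ->]]]] := homog_span G v; elim: n d c hc => [|n IH] d c hc.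
    by exists 0; split; [exact: homog0 | rewrite big_ord0 subr0; exact: OffDegree0].
  rewrite big_ord_recl.
  have [w [hw ow]] := IH (fun j => d (fintype.lift ord0 j)) _ (fun j => hc (fintype.lift ord0 j)).
  have [di|di] := eqVneq (d ord0) i.
    exists (c ord0 + w); split; first by apply: homogD => //; rewrite -di.
    by rewrite opprD addrACA subrr add0r.
  exists w; split=> //; rewrite -addrA; exact: OffDegreeD di (hc ord0) ow.
have uq v w w' : R v w -> R v w' -> w = w'.
  move=> [h1 o1] [h2 o2]; apply/eqP; rewrite -subr_eq0; apply/eqP.
  apply: (@off_homog0 i); first by rewrite addrC -scaleN1r; exact: homogP.
  have -> : w - w' = (-1) *: (v - w) + (v - w').
    by rewrite scaleN1r opprB addrA subrK.
  by apply: offD => //; exact: offZ.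
have [c hc] := choice ex; exists c; split=> [a u v|v hv|j v hv ji].
- apply: uq (hc _) _; have [h1 o1] := hc u; have [h2 o2] := hc v.
  split; first exact: homogP.
  by rewrite opprD addrACA -scalerBr; apply: offD => //; exact: offZ.
- by apply: uq (hc v) _; split=> //; rewrite subrr; exact: OffDegree0.
- apply: uq (hc v) _; split; first exact: homog0.
  by rewrite subr0 -[X in off_degree i X]addr0; apply: (OffDegreeD ji hv); exact: OffDegree0.
Qed.

End GradingTheory.

Section TensorGrading.
Variables (k : fieldType) (U V : lmodType k) (GU : grading U) (GV : grading V).

Inductive tensor_homog (n : int) : tensor U V -> Prop :=
| TensorHomog0 : tensor_homog n 0
| TensorHomogP c s t :
    tensor_homog n s -> tensor_homog n t -> tensor_homog n (c *: s + t)
| TensorHomogTens p q u v :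
    homog GU p u -> homog GV q v -> p + q = n -> tensor_homog n (u ⊗ v).

Lemma tensor_homog_span t :
  exists n (d : 'I_n -> int) (c : 'I_n -> tensor U V),
    (forall i, tensor_homog (d i) (c i)) /\ t = \sum_(i < n) c i.
Proof.
pose S t := exists n (d : 'I_n -> int) (c : 'I_n -> tensor U V),
  (forall i, tensor_homog (d i) (c i)) /\ t = \sum_(i < n) c i.
have S0 : S 0 by exists 0, (fun=> 0), (fun=> 0); split; [case|rewrite big_ord0].
have SD s1 s2 : S s1 -> S s2 -> S (s1 + s2).
  move=> [n1 [d1 [c1 [h1 ->]]]] [n2 [d2 [c2 [h2 ->]]]].
  exists (n1 + n2)%N,
    (fun i => match split i with inl j => d1 j | inr j => d2 j end),
    (fun i => match split i with inl j => c1 j | inr j => c2 j end).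
  split=> [i|]; first by case: (split i).
  rewrite big_split_ord; congr (_ + _); apply: eq_bigr => i _.
    by rewrite (unsplitK (inl i)).
  by rewrite (unsplitK (inr i)).
rewrite -/(S t); elim/tensor_ind: t => // u v t; apply: (SD).
have [n [d [c [hc ->]]]] := homog_span GU u.
have [m [e [b [hb ->]]]] := homog_span GV v.
rewrite tens_sum_l; apply: (big_rec S) => // i x _; apply: (SD).
rewrite linear_sum; apply: (big_rec S) => // j y _; apply: (SD).
exists 1%N, (fun=> d i + e j), (fun=> c i ⊗ b j); rewrite big_ord1; split=> // _.
exact: TensorHomogTens (hc i) (hb j) _.
Qed.

Lemma tensor_homog_direct (s : seq int) (c : int -> tensor U V) : uniq s ->
  (forall i, tensor_homog i (c i)) -> \sum_(i <- s) c i = 0 ->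
  forall i, i \in s -> c i = 0.
Proof.
move=> us hc s0 n ns.
have [cU hU] := choice (homog_component GU).
have [cV hV] := choice (homog_component GV).
have ex (pq : int * int) : exists f : tensor U V -> tensor U V,
    linear f /\ forall u v, f (u ⊗ v) = cU pq.1 u ⊗ cV pq.2 v.
  have [||f fl fE] := @tensor_lift _ U V _ (fun u v => cU pq.1 u ⊗ cV pq.2 v).
  - move=> v a u u' /=; have [-> _ _] := hU pq.1; exact: tens_linearl.
  - move=> u a v v' /=; have [-> _ _] := hV pq.2; exact: tens_linearr.
  by exists f.
have [pr hpr] := choice ex.
have prL pq := (hpr pq).1; have prE pq := (hpr pq).2.
have pr0 pq : pr pq 0 = 0.
  apply: (@addrI _ (pr pq 0)); rewrite addr0.
  by have := prL pq 1 0 0; rewrite !scale1r addr0.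
have tens0l v : (0 : U) ⊗ v = 0 by rewrite -(scale0r 0) tensZl scale0r.
have pr_off m t p q : tensor_homog m t -> p + q != m -> pr (p, q) t = 0.
  elim=> [|a t1 t2 _ IH1 _ IH2|p' q' u v hu hv <-] ne; first exact: pr0.
    by rewrite prL IH1 ?IH2 ?scaler0 ?addr0.
  rewrite prE /=; have [pp|pp] := eqVneq p' p; last first.
    by have [_ _ h0] := hU p; rewrite (h0 _ _ hu pp) tens0l.
  have [_ _ h0] := hV q; rewrite (h0 _ _ hv) ?linear0 //.
  by apply: contra ne => /eqP ->; rewrite pp.
have pr_id m t : tensor_homog m t -> exists ps : seq int, forall qs, uniq qs ->
    {subset ps <= qs} -> t = \sum_(p <- qs) pr (p, m - p) t.
  elim=> [|a t1 t2 _ [p1 h1] _ [p2 h2]|p q u v hu hv <-].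
  - by exists [::] => qs _ _; rewrite big1 // => p _; rewrite pr0.
  - exists (p1 ++ p2) => qs uqs sub.
    rewrite {1}(h1 qs) // => [|x xp]; last by rewrite sub // mem_cat xp.
    rewrite {1}(h2 qs) // => [|x xp]; last by rewrite sub // mem_cat xp orbT.
    rewrite scaler_sumr -big_split /=; apply: eq_bigr => p _; by rewrite prL.
  - exists [:: p] => qs uqs sub; have pq : p \in qs by apply: sub; exact: mem_head.
    rewrite (bigD1_seq p pq uqs) /= big1 ?addr0 => [|p' p'p].
      rewrite prE /= [p + q]addrC addrK.
      by have [_ -> // _] := hU p; have [_ -> // _] := hV q.
    rewrite prE /=; have [_ _ h0] := hU p'.
    by rewrite (h0 _ _ hu) ?tens0l // eq_sym.
have [ps hps] := pr_id n _ (hc n).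
rewrite (hps (undup ps)) ?undup_uniq // => [|x]; last by rewrite mem_undup.
rewrite big1 // => p _.
have prD a b : pr (p, n - p) (a + b) = pr (p, n - p) a + pr (p, n - p) b.
  by rewrite -[a]scale1r prL !scale1r.
have := congr1 (pr (p, n - p)) s0; rewrite pr0 (big_morph _ prD (pr0 _)).
rewrite (bigD1_seq n ns us) /= big1 ?addr0 // => j jn.
by apply: (pr_off j) => //; rewrite addrC subrK eq_sym.
Qed.

Definition tensor_grading : grading (tensor U V) :=
  Grading TensorHomog0 TensorHomogP tensor_homog_span tensor_homog_direct.

End TensorGrading.

Section Shuffles.
Variables (k : fieldType) (n : nat).

(* [b = [:: i_1; ...; i_r]] with sum [n]; [reshape_index b i] is the index of *)
(* the block containing position [i], and [s] has to increase on each block.  *)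
Definition shuffles (b : seq nat) : {set 'S_n} :=
  [set s : 'S_n | [forall i : 'I_n, forall j : 'I_n,
     ((i < j)%N && (reshape_index b i == reshape_index b j)) ==> (s i < s j)%N]].

(* The Koszul sign of [s] for elements of degrees [d 0, ..., d (n - 1)]: the  *)
(* relation v w = (-1)^(|v||w|) w v is used once for each inversion of [s].   *)
Definition koszul (d : 'I_n -> int) (s : 'S_n) : k :=
  \prod_(i < n) \prod_(j < n | (i < j)%N && (s j < s i)%N)
    (-1) ^ (d (s i) * d (s j)).

End Shuffles.

Arguments koszul k {n} d s.

Definition homogs (k : fieldType) (V : lmodType k) (G : grading V) n
    (d : 'I_n -> int) (x : 'I_n -> V) : Prop :=
  forall i, homog G (d i) (x i).

(* A family of maps of [V]^r, r >= 1, with values in [W] is encoded by one    *)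
(* function [f] of lists, the r-th map being the restriction of [f] to lists  *)
(* of length r; [f [::]] is a junk value on which nothing is assumed.  Linear *)
(* maps on the graded symmetric power S^r(V) are the multilinear maps on V^r  *)
(* that respect the relations v w = (-1)^(|v||w|) w v.                        *)
Section MapsOnSymmetricPowers.
Variables (k : fieldType) (V W : lmodType k) (G : grading V) (f : seq V -> W).

Definition multilinear : Prop := forall (s1 s2 : seq V) (c : k) (x y : V),
  f (s1 ++ (c *: x + y) :: s2) = c *: f (s1 ++ x :: s2) + f (s1 ++ y :: s2).

Definition graded_symmetric : Prop :=
  forall (s1 s2 : seq V) (p q : int) (x y : V), homog G p x -> homog G q y ->
  f (s1 ++ x :: y :: s2) = (-1) ^ (p * q) *: f (s1 ++ y :: x :: s2).

End MapsOnSymmetricPowers.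

Record linfty (k : fieldType) (g : lmodType k) (G : grading g) := LInfty {
  bracket :> seq g -> g;
  bracket_multilinear : multilinear bracket;
  bracket_symmetric : graded_symmetric G bracket;
  bracket_degree : forall n (d : 'I_n -> int) (x : 'I_n -> g), (0 < n)%N ->
    homogs G d x -> homog G (\sum_(i < n) d i + 1) (bracket [seq x i | i : 'I_n]);
  bracket_jacobi : forall n (d : 'I_n -> int) (x : 'I_n -> g), (0 < n)%N ->
    homogs G d x ->
    \sum_(1 <= i < n.+1) \sum_(s in shuffles n [:: i; (n - i)%N])
      koszul k d s *:
        (let xs := [seq x (s j) | j : 'I_n] in
         bracket (bracket (take i xs) :: drop i xs)) = 0
}.

Record gcalgebra (k : fieldType) (A : algType k) := GCAlgebra {
  gc_grading :> grading A;
  gc_one : homog gc_grading 0 1;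
  gc_mul : forall p q a b, homog gc_grading p a -> homog gc_grading q b ->
    homog gc_grading (p + q) (a * b);
  gc_comm : forall p q a b, homog gc_grading p a -> homog gc_grading q b ->
    a * b = (-1) ^ (p * q) *: (b * a)
}.

Record derivation (k : fieldType) (A : algType k) (GA : gcalgebra A) (n : int)
    (D : A -> A) : Prop := Derivation {
  derivation_linear : linear D;
  derivation_degree : forall p a, homog GA p a -> homog GA (n + p) (D a);
  derivation_leibniz : forall p a b, homog GA p a ->
    D (a * b) = D a * b + (-1) ^ (n * p) *: (a * D b)
}.

Record differential (k : fieldType) (A : algType k) (GA : gcalgebra A) :=
  Differential {
    diff :> A -> A;
    diff_derivation : derivation GA 1 diff;
    diff_diff : forall a, diff (diff a) = 0
  }.

Lemma zero_derivation (k : fieldType) (A : algType k) (GA : gcalgebra A) n :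
  derivation GA n (fun=> 0).
Proof.
split=> [c a b|p a _|p a b _]; first by rewrite scaler0 addr0.
  exact: homog0.
by rewrite mul0r mulr0 scaler0 addr0.
Qed.

Definition zero_differential (k : fieldType) (A : algType k) (GA : gcalgebra A) :
    differential GA :=
  Differential (zero_derivation GA 1) (fun=> erefl).

Record linfty_action (k : fieldType) (g : lmodType k) (G : grading g)
    (l : linfty G) (A : algType k) (GA : gcalgebra A) (d : differential GA) :=
  LInftyAction {
    rho :> seq g -> A -> A;
    rho_multilinear : forall a, multilinear (fun xs => rho xs a);
    rho_symmetric : forall a, graded_symmetric G (fun xs => rho xs a);
    rho_derivation : forall n (e : 'I_n -> int) (x : 'I_n -> g), (0 < n)%N ->
      homogs G e x ->
      derivation GA (\sum_(i < n) e i + 1) (rho [seq x i | i : 'I_n]);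
    rho_action : forall n (e : 'I_n -> int) (x : 'I_n -> g) (a : A), (0 < n)%N ->
      homogs G e x ->
      \sum_(1 <= i < n.+1) \sum_(s in shuffles n [:: i; (n - i)%N])
        koszul k e s *:
          (let xs := [seq x (s j) | j : 'I_n] in
           rho (l (take i xs) :: drop i xs) a)
      + \sum_(1 <= i < n) \sum_(s in shuffles n [:: i; (n - i)%N])
        (koszul k e s * (-1) ^ (\sum_(j < n | (j < i)%N) e (s j))) *:
          (let xs := [seq x (s j) | j : 'I_n] in
           rho (take i xs) (rho (drop i xs) a))
      + d (rho [seq x i | i : 'I_n] a)
      - (-1) ^ (\sum_(i < n) e i + 1) *: rho [seq x i | i : 'I_n] (d a) = 0
  }.

(* [act] is the A-module structure on [g], which is a graded one and restricts*)
(* to the vector space structure along k -> A.                                *)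
Record linfty_algebroid (k : fieldType) (A : algType k) (GA : gcalgebra A)
    (g : lmodType k) (G : grading g) := LInftyAlgebroid {
  algebroid_linfty :> linfty G;
  act : A -> g -> g;
  act_linearl : forall x, linear (act^~ x);
  act_linearr : forall a, linear (act a);
  act_one : forall x, act 1 x = x;
  act_mul : forall a b x, act (a * b) x = act a (act b x);
  act_degree : forall p q a x, homog GA p a -> homog G q x ->
    homog G (p + q) (act a x);
  anchor : linfty_action algebroid_linfty (zero_differential GA);
  anchor_act : forall p (a : A) (x : g) (xs : seq g) (b : A), homog GA p a ->
    anchor (act a x :: xs) b = (-1) ^ p *: (a * anchor (x :: xs) b);
  bracket_act : forall n (e : 'I_n -> int) (x : 'I_n -> g) p (a : A) (y : g),
    (0 < n)%N -> homogs G e x -> homog GA p a ->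
    let xs := [seq x i | i : 'I_n] in
    algebroid_linfty (rcons xs (act a y)) =
      act (anchor xs a) y
      + (-1) ^ (p * (1 + \sum_(i < n) e i))
          *: act a (algebroid_linfty (rcons xs y))
}.

(* [M xs ys] is M_{p,q} for p = size xs and q = size ys; it is meaningful for *)
(* q >= 1 only.                                                               *)
Record postlie_infty (k : fieldType) (g : lmodType k) (G : grading g) :=
  PostLieInfty {
    postlie :> seq g -> seq g -> g;
    postlie_multilinearl : forall ys, (0 < size ys)%N ->
      multilinear (postlie^~ ys);
    postlie_multilinearr : forall xs, multilinear (postlie xs);
    postlie_symmetricl : forall ys, (0 < size ys)%N ->
      graded_symmetric G (postlie^~ ys);
    postlie_symmetricr : forall xs, graded_symmetric G (postlie xs);
    postlie_degree : forall n m (d : 'I_n -> int) (e : 'I_m -> int)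
        (x : 'I_n -> g) (y : 'I_m -> g), (0 < m)%N ->
      homogs G d x -> homogs G e y ->
      homog G (\sum_(i < n) d i + \sum_(i < m) e i + 1)
        (postlie [seq x i | i : 'I_n] [seq y i | i : 'I_m]);
    (* [y i] stands for x_{n+1+i} *)
    postlie_relation : forall n m (d : 'I_n -> int) (e : 'I_m -> int)
        (x : 'I_n -> g) (y : 'I_m -> g), (0 < m)%N ->
      homogs G d x -> homogs G e y ->
      \sum_(0 <= j < n) \sum_(1 <= i < (n - j).+1)
        \sum_(s in shuffles n [:: j; i; (n - j - i)%N])
        koszul k d s *:
          (let xs := [seq x (s h) | h : 'I_n] in
           let ys := [seq y h | h : 'I_m] in
           postlie (postlie (take j xs) (take i (drop j xs)) :: drop (j + i) xs)
             ys)
      + \sum_(0 <= j < n.+1) \sum_(s in shuffles n [:: (n - j)%N; j])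
        \sum_(1 <= i < m.+1) \sum_(t in shuffles m [:: i; (m - i)%N])
        (koszul k d s * koszul k e t
           * (-1) ^ (\sum_(h < n | (h < n - j)%N) d (s h))) *:
          (let xs := [seq x (s h) | h : 'I_n] in
           let ys := [seq y (t h) | h : 'I_m] in
           postlie (take (n - j) xs)
             (postlie (drop (n - j) xs) (take i ys) :: drop i ys)) = 0
  }.

(* For degrees [p i] of a_i and [d i] of x_i.                                 *)
Definition tensor_sign (k : fieldType) n (p d : 'I_n -> int) : k :=
  (-1) ^ (\sum_(i < n) (1 + \sum_(j < n | (j < i)%N) d j) * p i).

Arguments tensor_sign k {n} p d.

(* Main.v *)
Require Import Defs.
From HB Require Import structures.
From mathcomp Require Import all_boot all_order all_fingroup all_algebra.
From mathcomp Require Import boolp ring zify.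
From Stdlib Require Import Btauto.

Set Implicit Arguments.
Unset Strict Implicit.
Unset Printing Implicit Defensive.

Import GRing.Theory.
Local Open Scope ring_scope.

(* Moving all coefficients a_i to the front of a word a_1 ⊗ x_1, ..., a_n ⊗ x_n
   turns the Koszul sign of a permutation of the a_i ⊗ x_i into the Koszul sign
   of the same permutation of the x_i.  Hence, shuffle by shuffle, the terms of
   the relation in which no anchor differentiates a coefficient are a fixed
   multiple of the terms of the Jacobi identities or of the action identities
   of the x_i, and they cancel.  The remaining terms come from a derivation
   rho(x_1, ..., x_j) acting on a product of coefficients.  By the Leibniz rule
   such a term is a sum over the factors of that product, and moving the factor
   that is hit to the front of its block identifies a (j, n - j)-shuffle with a
   chosen letter in the second block with a (j, 1, n - j - 1)-shuffle; these
   are the terms in which M_{j,1} is nested in the first slot (or, when M_{n,1}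
   meets M_{0,m}, the terms in which M_{n,1} is nested in the second slot).
   Signs are compared through the parities of their exponents. *)

(** * Signs *)

(** The formulas fix the operations on homogeneous pure tensors only, with signs that depend on
    degrees, whereas the structure asks for maps on lists of arbitrary tensors. [koszul_ext] bridges
    this: it consumes a list by the universal property of the tensor product and produces signs
    linearly, twisting each coefficient by the parity accumulated so far and splitting each second
    factor into even and odd parts. Only parities have to be remembered, so a Boolean state
    suffices. Conversely, identities are checked on pure tensors only. A homogeneous tensor is a
    combination of pure ones of the same total degree, so the Koszul signs in the relation stay
    fixed during this reduction. An operation with [p] and [q] arguments vanishes unless [p = 0] or
    [q = 1], which leaves few cases of the relation. For [n = 0] it is the Jacobi identity of the
    extended bracket. For [n > 0] the two extreme terms of the second sum cancel each other; nothing
    else survives if [m > 1], and for [m = 1] the rest is the action identity of the extended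
    anchor, corrected by the terms in which it differentiates coefficients. *)

Definition podd (z : int) : bool := odd `|z|%N.

Lemma poddD x y : podd (x + y) = podd x (+) podd y.
Proof. rewrite /podd; lia. Qed.

Lemma poddM x y : podd (x * y) = podd x && podd y.
Proof. by rewrite /podd abszM oddM. Qed.

Lemma poddN x : podd (- x) = podd x.
Proof. by rewrite /podd abszN. Qed.

Lemma podd_nat (b : bool) : podd b = b.
Proof. by case: b. Qed.

(** Prepares goals for [btauto], which works with [xorb]. *)
Lemma addb_xorb a b : a (+) b = xorb a b.
Proof. by case: a; case: b. Qed.

Lemma podd1 : podd 1 = true. Proof. by []. Qed.

Definition poddE := (poddD, poddM, poddN, podd1, podd_nat).

Section Signs.
Variable k : fieldType.

Lemma signzE z : (-1) ^ z = (-1) ^+ podd z :> k.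
Proof.
rewrite /podd signr_odd; case: z => n //.
by rewrite /exprz /= -exprVn invrN1.
Qed.

Lemma signz_podd x y : podd x = podd y -> (-1) ^ x = (-1) ^ y :> k.
Proof. by move=> e; rewrite !signzE e. Qed.

Lemma signzD x y : (-1) ^ x * (-1) ^ y = (-1) ^ (x + y) :> k.
Proof. by rewrite exprzDr // unitrN1. Qed.

Lemma signz0 : (-1) ^ (0 : int) = 1 :> k. Proof. by []. Qed.

Lemma signzNr x : - (-1) ^ x = (-1) ^ (x + 1) :> k.
Proof. by rewrite -signzD mulrN1. Qed.

Lemma signz_even x : podd x = false -> (-1) ^ x = 1 :> k.
Proof. by rewrite signzE => ->. Qed.

End Signs.

(* The atoms are generalized up to conversion, [btauto] being syntactic. *)
Ltac podd_tauto := rewrite ?poddE ?addb_xorb;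
  repeat match goal with |- context [podd ?x] => move: (podd x) => ? end; btauto.
Ltac parity := rewrite ?signzD; apply: signz_podd; podd_tauto.

(** * Linear extension to tensor products *)

Section LinearFunctions.
Variables (k : fieldType) (V W : lmodType k) (f : V -> W).
Hypothesis fl : linear f.

Lemma linear_fun0 : f 0 = 0.
Proof. by have := fl (-1) 0 0; rewrite scaler0 addr0 scaleN1r addNr. Qed.

Lemma linear_funD u v : f (u + v) = f u + f v.
Proof. by have := fl 1 u v; rewrite !scale1r. Qed.

Lemma linear_funZ c u : f (c *: u) = c *: f u.
Proof. by have := fl c u 0; rewrite !addr0 linear_fun0 addr0. Qed.

Lemma linear_fun_sum I (r : seq I) (P : pred I) (F : I -> V) :
  f (\sum_(i <- r | P i) F i) = \sum_(i <- r | P i) f (F i).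
Proof. exact: (big_morph f linear_funD linear_fun0). Qed.
End LinearFunctions.

Section GradedScaling.
Variables (k : fieldType) (V : lmodType k) (G : grading V).

(** [T v] is the unique vector whose component in each degree [j] is [phi j] times that of [v].
    Uniqueness holds because a vector without nonzero components is zero, and it makes the chosen
    [T] linear. *)
Lemma graded_scaling (phi : int -> k) :
  {T : V -> V | linear T & forall p v, homog G p v -> T v = phi p *: v}.
Proof.
apply/cid2; have [pr hpr] := choice (homog_component G).
have prl j : linear (pr j) by have [] := hpr j.
have pr_id j v : homog G j v -> pr j v = v by have [_ + _] := hpr j; apply.
have pr_off j p v : homog G p v -> p != j -> pr j v = 0.
  by have [_ _ +] := hpr j; apply.
have inj v : (forall j, pr j v = 0) -> v = 0.
  have [n [d [c [hc ->]]]] := homog_span G v => h0.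
  (* Only the finitely many degrees occurring in [v] contribute, so [v] is recovered as the sum of
     its components over [s]. *)
  pose s := undup [seq d i | i : 'I_n].
  have -> : \sum_(i < n) c i = \sum_(j <- s) pr j (\sum_(i < n) c i).
    rewrite (eq_bigr (fun j => \sum_(i < n) pr j (c i))); last first.
      by move=> j _; rewrite (linear_fun_sum (prl j)).
    rewrite exchange_big /=; apply: eq_bigr => i _.
    have ds : d i \in s by rewrite mem_undup map_f ?mem_enum.
    rewrite (bigD1_seq (d i)) ?undup_uniq //= pr_id // big1 ?addr0 // => j ji.
    by apply: pr_off (hc i) _; rewrite eq_sym.
  by rewrite big1.
pose R v w := forall j, pr j w = phi j *: pr j v.
have ex v : exists w, R v w.
  have [n [d [c [hc ->]]]] := homog_span G v.
  exists (\sum_(i < n) phi (d i) *: c i) => j.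
  rewrite !(linear_fun_sum (prl j)) scaler_sumr; apply: eq_bigr => i _.
  rewrite (linear_funZ (prl j)); have [<- //|dj] := eqVneq (d i) j.
  by rewrite (pr_off _ _ _ (hc i) dj) !scaler0.
have uq v w w' : R v w -> R v w' -> w = w'.
  move=> h1 h2; apply/eqP; rewrite -subr_eq0; apply/eqP/inj => j.
  by rewrite -scaleN1r addrC prl h1 h2 scaleN1r addNr.
have [T hT] := choice ex.
have TE v w : R v w -> T v = w by exact: uq (hT v).
exists T => [c u v|p v hv]; apply: TE => j.
- rewrite !prl !hT.
  by rewrite !scalerDr !scalerA mulrC.
- rewrite (linear_funZ (prl j)); have [<- //|pj] := eqVneq p j.
  by rewrite (pr_off _ _ _ hv pj) !scaler0.
Qed.

Definition grade_scale (phi : int -> k) : V -> V := s2val (graded_scaling phi).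

Lemma grade_scale_linear phi : linear (grade_scale phi).
Proof. by rewrite /grade_scale; case: graded_scaling. Qed.

Lemma grade_scaleE phi p v :
  homog G p v -> grade_scale phi v = phi p *: v.
Proof.
by rewrite /grade_scale; case: graded_scaling => T _ /=; apply.
Qed.

End GradedScaling.

Section TensorLift.
Variables (k : fieldType) (U V W : lmodType k).

Definition bilinear_fun (f : U -> V -> W) :=
  (forall v, linear (f^~ v)) /\ (forall u, linear (f u)).

(* The junk value [0] is returned when [f] is not bilinear. *)
Definition tlift (f : U -> V -> W) : tensor U V -> W :=
  match pselect (bilinear_fun f) with
  | left h => s2val (cid2 (tensor_lift h.1 h.2))
  | right _ => fun=> 0
  end.

Lemma tlift_linear f : linear (tlift f).
Proof.
rewrite /tlift; case: pselect => [h|_]; first by case: cid2.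
by move=> c u v; rewrite scaler0 addr0.
Qed.

Lemma tliftE f u v : bilinear_fun f -> tlift f (u ⊗ v) = f u v.
Proof. by rewrite /tlift; case: pselect => // h _; case: cid2 => f' _ /=. Qed.

Lemma linear_tensor_ext (f h : tensor U V -> W) : linear f -> linear h ->
  (forall u v, f (u ⊗ v) = h (u ⊗ v)) -> f =1 h.
Proof.
move=> fl hl e t; elim/tensor_ind: t => [|u v t IH].
  by rewrite !linear_fun0.
by rewrite !linear_funD // e IH.
Qed.

Lemma linear_comb (f h : tensor U V -> W) c : linear f -> linear h ->
  linear (fun t => c *: f t + h t).
Proof.
move=> fl hl z u v; rewrite fl hl !scalerDr !scalerA mulrC -!addrA.
by congr (_ + _); rewrite addrCA.
Qed.

Lemma tlift_comb (f1 f2 : U -> V -> W) c :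
    bilinear_fun f1 -> bilinear_fun f2 ->
  forall t, tlift (fun u v => c *: f1 u v + f2 u v) t
    = c *: tlift f1 t + tlift f2 t.
Proof.
move=> [l1 r1] [l2 r2]; apply: linear_tensor_ext.
- exact: tlift_linear.
- by apply: linear_comb; exact: tlift_linear.
move=> u v; rewrite !tliftE //; split=> [v'|u'] z a b /=.
  rewrite l1 l2 !scalerDr !scalerA mulrC -!addrA.
  by congr (_ + _); rewrite addrCA.
rewrite r1 r2 !scalerDr !scalerA mulrC -!addrA.
by congr (_ + _); rewrite addrCA.
Qed.

End TensorLift.

(** * Koszul-signed extension of multilinear maps to A ⊗ g *)

Section KoszulExtension.
Variables (k : fieldType) (A : algType k) (GA : gcalgebra A).
Variables (g : lmodType k) (G : grading g) (W : lmodType k).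
Implicit Types (th : A -> seq g -> W) (c : bool) (ts : seq (tensor A g)).

Definition sign_twist c : A -> A :=
  grade_scale GA (fun p => (-1) ^+ (c && podd p)).
Definition parity_part (b : bool) : g -> g :=
  grade_scale G (fun d => (podd d == b)%:R).

(** Letters already consumed are stored in [th]: linearity in a letter thus becomes linearity in
    [th], which is why [theta_comb] and [koszul_ext_comb] come before the multilinearity of
    [koszul_ext]. *)
Definition prepend th (a : A) (x : g) : A -> seq g -> W :=
  fun a' xs => th (a * a') (x :: xs).

(* On pure tensors a_i ⊗ x_i this moves the a_i to the left of the x_j, and of*)
(* a symbol whose degree has parity [c], before applying [th].                *)
Fixpoint koszul_ext c th ts : W :=
  match ts with
  | [::] => th 1 [::]
  | t :: ts' => tlift (fun a x =>
      koszul_ext c (prepend th (sign_twist c a) (parity_part false x)) ts'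
      + koszul_ext (~~ c) (prepend th (sign_twist c a) (parity_part true x)) ts') t
  end.

Definition multilinear_on th :=
  (forall xs, linear (th^~ xs)) /\ (forall a, multilinear (th a)).

Definition theta_comb (z : k) th1 th2 : A -> seq g -> W :=
  fun a xs => z *: th1 a xs + th2 a xs.

Lemma scale_comb_swap (z z' : k) (u v u' v' : W) :
  z *: (z' *: u + v) + (z' *: u' + v') = z' *: (z *: u + u') + (z *: v + v').
Proof.
by rewrite !scalerDr !scalerA [z * z']mulrC -!addrA; congr (_ + _); rewrite addrCA.
Qed.

Lemma multilinear_on_prepend th a x :
  multilinear_on th -> multilinear_on (prepend th a x).
Proof.
move=> [l m]; split=> [xs z u v|u s1 s2 z x1 x2].
  by rewrite /prepend mulrDr -scalerAr l.
by rewrite /prepend; have := m (a * u) (x :: s1) s2 z x1 x2.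
Qed.

Lemma prependl z th a b x : multilinear_on th ->
  prepend th (z *: a + b) x = theta_comb z (prepend th a x) (prepend th b x).
Proof.
move=> [l m]; apply/funext => u; apply/funext => xs.
by rewrite /theta_comb /prepend mulrDl -scalerAl l.
Qed.

Lemma prependr z th a x y : multilinear_on th ->
  prepend th a (z *: x + y) = theta_comb z (prepend th a x) (prepend th a y).
Proof.
move=> [l m]; apply/funext => u; apply/funext => xs.
by rewrite /theta_comb /prepend; exact: (m (a * u) [::] xs z x y).
Qed.

Let step c th ts a x :=
  koszul_ext c (prepend th (sign_twist c a) (parity_part false x)) ts
  + koszul_ext (~~ c) (prepend th (sign_twist c a) (parity_part true x)) ts.

Let twl c : linear (sign_twist c). Proof. exact: grade_scale_linear. Qed.
Let ppl b : linear (parity_part b). Proof. exact: grade_scale_linear. Qed.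

Let mp := multilinear_on_prepend.

(** Linearity in [th] for the tail [ts] is a hypothesis because [koszul_ext_comb], which provides
    it, needs this very bilinearity in its induction step: [tlift] computes nothing on a function
    that is not bilinear. *)
Let step_bilinear c th ts : multilinear_on th ->
    (forall c z th1 th2, multilinear_on th1 -> multilinear_on th2 ->
      koszul_ext c (theta_comb z th1 th2) ts
        = z *: koszul_ext c th1 ts + koszul_ext c th2 ts) ->
  bilinear_fun (step c th ts).
Proof.
move=> mth L; split=> [x|a] z u v.
  rewrite /step twl !prependl // !L; try exact: mp.
  by rewrite -!addrA scalerDr -!addrA; congr (_ + _); rewrite addrCA.
rewrite /step !ppl !prependr // !L; try exact: mp.
by rewrite -!addrA scalerDr -!addrA; congr (_ + _); rewrite addrCA.
Qed.

Lemma koszul_ext_comb ts c z th1 th2 : multilinear_on th1 -> multilinear_on th2 ->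
  koszul_ext c (theta_comb z th1 th2) ts
    = z *: koszul_ext c th1 ts + koszul_ext c th2 ts.
Proof.
elim: ts c z th1 th2 => [//|t ts IH] c z th1 th2 h1 h2.
rewrite [LHS]/= [in RHS]/= -tlift_comb; last 2 first.
- exact: step_bilinear.
- exact: step_bilinear.
congr (tlift _ t); apply/funext => a; apply/funext => x.
rewrite scalerDr addrACA -!IH; try exact: mp.
by [].
Qed.

Lemma koszul_ext_bilinear c th ts : multilinear_on th ->
  bilinear_fun (step c th ts).
Proof. by move=> h; apply: step_bilinear => // *; exact: koszul_ext_comb. Qed.

Lemma koszul_ext0 c th ts : (forall a xs, th a xs = 0) -> koszul_ext c th ts = 0.
Proof.
move=> th0.
have m0 : multilinear_on (fun _ _ => 0).
  by split=> [xs z a b|a s1 s2 z x y]; rewrite scaler0 addr0.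
have -> : th = fun _ _ => 0 by apply/funext => a; apply/funext => xs.
have := koszul_ext_comb ts c (-1) m0 m0; rewrite scaleN1r addNr.
apply: etrans; congr (koszul_ext c _ ts); apply/funext => a; apply/funext => xs.
by rewrite /theta_comb scaler0 addr0.
Qed.

Lemma koszul_extZ c z th ts : multilinear_on th ->
  koszul_ext c (fun a xs => z *: th a xs) ts = z *: koszul_ext c th ts.
Proof.
move=> h.
have m0 : multilinear_on (fun _ _ => 0).
  by split=> [xs y a b|a s1 s2 y x1 x2]; rewrite scaler0 addr0.
rewrite -[RHS]addr0 -(@koszul_ext0 c (fun _ _ => 0) ts) // -koszul_ext_comb //.
congr (koszul_ext c _ ts); apply/funext => a; apply/funext => xs.
by rewrite /theta_comb addr0.
Qed.

(** For homogeneous [x] one of the two parity parts is zero and kills its summand; the other one is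
    [x] and updates the state by the parity of [d]. *)
Lemma koszul_ext_cons (c : int) th ts p d a x : multilinear_on th ->
    homog GA p a -> homog G d x ->
  koszul_ext (podd c) th (a ⊗ x :: ts) =
    (-1) ^ (c * p) *: koszul_ext (podd (c + d)) (prepend th a x) ts.
Proof.
move=> mth ha hx; rewrite /= tliftE; last exact: koszul_ext_bilinear.
have -> : sign_twist (podd c) a = (-1) ^ (c * p) *: a.
  by rewrite /sign_twist (grade_scaleE _ ha) -poddM -signzE.
rewrite /parity_part !(grade_scaleE _ hx).
have P0 c' u : koszul_ext c' (prepend th u 0) ts = 0.
  apply: koszul_ext0 => a' xs; rewrite /prepend.
  have := mth.2 (u * a') [::] xs (-1) 0 0.
  by rewrite scaler0 addr0 scaleN1r addNr.
have PZ u : prepend th ((-1) ^ (c * p) *: a) u =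
    fun a' xs => (-1) ^ (c * p) *: prepend th a u a' xs.
  apply/funext => b; apply/funext => xs.
  by rewrite /prepend -scalerAl (linear_funZ (mth.1 _)).
rewrite poddD; case: (podd d); rewrite scale0r scale1r P0 ?addr0 ?add0r PZ.
  by rewrite addbT koszul_extZ //; exact: mp.
by rewrite addbF koszul_extZ //; exact: mp.
Qed.

Lemma koszul_ext_consZ c th z t ts :
  koszul_ext c th (z *: t :: ts) = z *: koszul_ext c th (t :: ts).
Proof. exact: linear_funZ (tlift_linear _) _ _. Qed.

Lemma koszul_ext_multilinear c th :
  multilinear_on th -> multilinear (koszul_ext c th).
Proof.
move=> mth s1 s2 z x y; elim: s1 c th mth => [|t s1 IH] c th mth.
  exact: tlift_linear.
rewrite !cat_cons /= -tlift_comb; try exact: koszul_ext_bilinear.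
congr (tlift _ t); apply/funext => a; apply/funext => x'.
by rewrite !IH; try exact: mp; rewrite scalerDr addrACA.
Qed.

(** For pure tensors the sign [(p1 + d1) * (p2 + d2)] splits into [p1 * p2] from commuting
    coefficients, [d1 * d2] from the symmetry of [th], and the two mixed products from moving
    coefficients past the second factors. *)
Lemma koszul_ext_symmetric c th : multilinear_on th ->
  (forall a, graded_symmetric G (th a)) ->
  graded_symmetric (tensor_grading GA G) (koszul_ext c th).
Proof.
move=> mth sth s1 s2 p q x y hx hy.
elim: s1 c th mth sth => [|t s1 IH] c th mth sth; last first.
  rewrite !cat_cons; move: t; apply: linear_tensor_ext.
  - exact: tlift_linear.
  - by move=> z u v; rewrite [in LHS]/= tlift_linear scalerDr !scalerA mulrC.
  move=> a x' /=; rewrite !tliftE; try exact: koszul_ext_bilinear.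
  rewrite scalerDr !IH //; try exact: mp.
    by move=> u r1 r2 p' q' x1 x2; exact: (sth _ (_ :: r1)).
  by move=> u r1 r2 p' q' x1 x2; exact: (sth _ (_ :: r1)).
have lin2 t0 : linear (fun t => koszul_ext c th (t0 :: t :: s2)).
  exact: (koszul_ext_multilinear c mth [:: t0] s2).
have lin1 t0 : linear (fun t => koszul_ext c th (t :: t0 :: s2)).
  exact: (koszul_ext_multilinear c mth [::] (t0 :: s2)).
elim: hx => [|z u v _ IHu _ IHv|p1 d1 a1 x1 ha1 hx1 <-].
- by rewrite (linear_fun0 (lin1 y)) (linear_fun0 (lin2 y)) scaler0.
- by rewrite (lin1 y) (lin2 y) IHu IHv !scalerDr !scalerA mulrC.
elim: hy => [|z u v _ IHu _ IHv|p2 d2 a2 x2 ha2 hx2 <-].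
- by rewrite (linear_fun0 (lin1 _)) (linear_fun0 (lin2 _)) scaler0.
- by rewrite (lin1 _) (lin2 _) IHu IHv !scalerDr !scalerA mulrC.
(* [koszul_ext_cons] takes an integer state, so the Boolean is replaced by an integer of that
   parity. *)
clear lin1 lin2; rewrite -(podd_nat c); move: (Posz c) => {}c.
rewrite !(koszul_ext_cons _ _ _ ha1 hx1) //; try exact: mp.
rewrite !(koszul_ext_cons _ _ _ ha2 hx2) //; try exact: mp.
rewrite !(koszul_ext_cons _ _ _ ha1 hx1) //; try exact: mp.
have -> : prepend (prepend th a1 x1) a2 x2 =
    fun a xs => (-1) ^ (p1 * p2 + d1 * d2) *: prepend (prepend th a2 x2) a1 x1 a xs.
  apply/funext => a; apply/funext => xs; rewrite /prepend !mulrA.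
  rewrite (gc_comm ha1 ha2) -scalerAl (linear_funZ (mth.1 _)).
  rewrite (sth _ [::] xs _ _ _ _ hx1 hx2) scalerA; congr (_ *: _).
  parity.
rewrite koszul_extZ; last by do 2 apply: mp.
rewrite !scalerA [in RHS]addrAC; congr (_ *: _); parity.
Qed.

End KoszulExtension.
Arguments koszul_ext {k A} GA {g} G {W} c th ts : simpl never.

(** * Signs of reordered words *)

Section SwapInvariance.
Variables (T : eqType) (R : Type) (F : seq T -> R).
Hypothesis Fswap : forall s1 s2 x y, x != y ->
  F (s1 ++ x :: y :: s2) = F (s1 ++ y :: x :: s2).

Lemma swap_invariant_perm s t : perm_eq s t -> F s = F t.
Proof.
have swap s1 s2 x y : F (s1 ++ x :: y :: s2) = F (s1 ++ y :: x :: s2).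
  by have [->|] := eqVneq x y; last exact: Fswap.
have move_front s0 t1 t2 x : F (s0 ++ t1 ++ x :: t2) = F (s0 ++ x :: t1 ++ t2).
  elim: t1 s0 => [//|y t1 IH] s0.
  by rewrite -[LHS]/(F (s0 ++ y :: (t1 ++ x :: t2))) -cat_rcons IH cat_rcons swap.
suff gen s0 : perm_eq s t -> F (s0 ++ s) = F (s0 ++ t) by exact: (gen [::]).
elim: s t s0 => [|x s IH] t s0 st.
  by move: st; rewrite perm_sym => /perm_nilP ->.
have xt : x \in t by rewrite -(perm_mem st) mem_head.
case/splitPr: xt st => t1 t2 st.
rewrite move_front -!(cat_rcons x); apply: IH.
by move: st; rewrite perm_sym -(cat1s x t2) perm_catCA /= perm_cons perm_sym.
Qed.
End SwapInvariance.

Section InversionDegree.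
Variables (n : nat) (e : 'I_n -> int).

(* The exponent of the Koszul sign of the word [r] in letters of degrees [e]. *)
Fixpoint inv_deg (r : seq 'I_n) : int :=
  if r is i :: r' then e i * (\sum_(j <- r' | (j < i)%N) e j) + inv_deg r' else 0.

Lemma inv_deg_cat r1 r2 r2' : perm_eq r2 r2' ->
  inv_deg (r1 ++ r2) = inv_deg (r1 ++ r2') + (inv_deg r2 - inv_deg r2').
Proof.
move=> h; elim: r1 => [|i r1 IH] /=; first by rewrite addrC subrK.
rewrite -!addrA IH; congr (_ * _ + _); apply: perm_big.
by rewrite perm_cat2l.
Qed.

(** Swapping neighbours changes the status of that one pair; distinctness ensures that exactly one
    of the two orders is an inversion. *)
Lemma inv_deg_swap r1 r2 i j : i != j ->
  podd (inv_deg (r1 ++ i :: j :: r2)) =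
  podd (inv_deg (r1 ++ j :: i :: r2) + e i * e j).
Proof.
move=> ij; have h : perm_eq (i :: j :: r2) (j :: i :: r2).
  by rewrite (perm_catCA [:: i] [:: j]).
rewrite (inv_deg_cat r1 h) /= !big_cons; move: ij; rewrite -val_eqE /= neq_ltn.
case/orP => lt; rewrite lt ltnNge (ltnW lt) /=; podd_tauto.
Qed.

Lemma inv_deg_sorted r : sorted (fun i j : 'I_n => i <= j)%N r -> inv_deg r = 0.
Proof.
have tr : transitive (fun i j : 'I_n => i <= j)%N by move=> ? ? ?; exact: leq_trans.
elim: r => //= i r IH; rewrite (path_sortedE tr) => /andP[/allP h /IH ->].
rewrite big_seq_cond big1 ?mulr0 // => j /andP[/h]; lia.
Qed.

(** All inversions involve [l] and a smaller letter, and in a sorted word the smaller letters are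
    those that preceded [l]. *)
Lemma inv_deg_front r l : sorted (fun i j : 'I_n => i <= j)%N r -> uniq r ->
  l \in r -> inv_deg (l :: rem l r) = e l * \sum_(j <- take (index l r) r) e j.
Proof.
have tr : transitive (fun i j : 'I_n => i <= j)%N by move=> ? ? ?; exact: leq_trans.
move=> sr ur lr /=.
rewrite inv_deg_sorted ?addr0; last exact: subseq_sorted (rem_subseq _ _) sr.
congr (_ * _); elim: r sr ur lr => //= i r IH.
rewrite (path_sortedE tr) inE => /andP[/allP h sr] /andP[ir ur] /orP[/eqP ->|lr].
  rewrite eqxx /= big_nil big_seq_cond big1 // => j /andP[/h]; lia.
have il : i != l by apply: contraNneq ir => ->.
rewrite (negPf il) /= !big_cons IH //.
by have := h l lr; move: il; rewrite -val_eqE /= ltn_neqAle => -> ->.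
Qed.

End InversionDegree.

(** * Extended operations on words of homogeneous pure tensors *)

Section PureTensors.
Variables (k : fieldType) (A : algType k) (GA : gcalgebra A).
Variables (g : lmodType k) (G : grading g).
Variables (I : eqType) (p d : I -> int) (a : I -> A) (x : I -> g).
Hypotheses (ha : forall i, homog GA (p i) (a i)).
Hypotheses (hx : forall i, homog G (d i) (x i)).

(** The exponent of the sign for moving every coefficient of the word [r] to the front, past the
    earlier second factors and a symbol of degree [c]. *)
Fixpoint ext_deg (c : int) (r : seq I) : int :=
  if r is i :: r' then c * p i + ext_deg (c + d i) r' else 0.

Lemma ext_deg_cat c r1 r2 :
  ext_deg c (r1 ++ r2) = ext_deg c r1 + ext_deg (c + \sum_(i <- r1) d i) r2.
Proof.
elim: r1 c => [|i r1 IH] c /=; first by rewrite big_nil addr0 add0r.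
by rewrite IH big_cons !addrA.
Qed.

Lemma ext_degD c c' r :
  ext_deg (c + c') r = ext_deg c r + c' * \sum_(i <- r) p i.
Proof.
elim: r c => [|i r IH] c /=; first by rewrite big_nil mulr0 addr0.
by rewrite addrAC IH big_cons; ring.
Qed.

Lemma ext_deg1 r : ext_deg 1 r = ext_deg 0 r + \sum_(i <- r) p i.
Proof. by rewrite -[1]add0r ext_degD mul1r. Qed.

Let X i := a i ⊗ x i.

Lemma koszul_ext_pure (W : lmodType k) (c : int) (th : A -> seq g -> W) r :
    multilinear_on th ->
  koszul_ext GA G (podd c) th [seq X i | i <- r] =
    (-1) ^ ext_deg c r *: th (\prod_(i <- r) a i) [seq x i | i <- r].
Proof.
elim: r c th => [|i r IH] c th mth /=.
  by rewrite big_nil scale1r.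
rewrite (koszul_ext_cons _ _ _ (ha i) (hx i)) // IH; last exact: multilinear_on_prepend.
by rewrite scalerA signzD big_cons.
Qed.

Lemma homog_prod r : homog GA (\sum_(i <- r) p i) (\prod_(i <- r) a i).
Proof.
elim: r => [|i r IH]; first by rewrite !big_nil; exact: gc_one.
by rewrite !big_cons; exact: gc_mul.
Qed.

Lemma derivation1 delta D : derivation GA delta D -> D 1 = 0.
Proof.
move=> hD; have := derivation_leibniz hD 1 (gc_one GA).
by rewrite !mulr1 mulr0 scale1r mul1r -[X in X = _ -> _]addr0 => /addrI <-.
Qed.

(* The derivation extended to tensors by acting on the first factor is a      *)
(* derivation of the extended multilinear operation.                          *)
Lemma koszul_ext_leibniz (W : lmodType k) (c delta : int) (D : A -> A)
    (th : A -> seq g -> W) r :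
    derivation GA delta D -> multilinear_on th ->
    (forall u, graded_symmetric G (th u)) -> uniq r ->
  (-1) ^ ext_deg c r *: th (D (\prod_(i <- r) a i)) [seq x i | i <- r] =
  (-1) ^ (delta * c) *: \sum_(l <- r)
     (-1) ^ ((p l + d l) * \sum_(j <- take (index l r) r) (p j + d j)) *:
     koszul_ext GA G (podd c) th (D (a l) ⊗ x l :: [seq X i | i <- rem l r]).
Proof.
move=> hD; elim: r c th => [|i r IH] c th mth sth.
  move=> _; rewrite !big_nil (derivation1 hD) scaler0.
  by rewrite (linear_fun0 (mth.1 _)) scaler0.
move=> /= /andP[ir ur].
have hDX l : tensor_homog GA G (delta + p l + d l) (D (a l) ⊗ x l).
  by apply: TensorHomogTens (hx l) _; [exact: (derivation_degree hD) | ].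
have hX l : tensor_homog GA G (p l + d l) (X l).
  exact: TensorHomogTens (ha l) (hx l) _.
rewrite !big_cons eqxx take0 big_nil mulr0 signz0 scale1r.
rewrite (koszul_ext_cons _ _ _ (derivation_degree hD (ha i)) (hx i)) //.
rewrite koszul_ext_pure; last exact: multilinear_on_prepend.
rewrite (derivation_leibniz hD _ (ha i)).
rewrite (linear_funD (mth.1 _)).
rewrite (linear_funZ (mth.1 _)) !scalerDr !scalerA; congr (_ + _).
  congr (_ *: _); parity.
have := IH (c + d i) (prepend th (a i) (x i)) (multilinear_on_prepend _ _ mth).
rewrite /prepend => IH'.
rewrite -signzD [_ * (-1) ^ ext_deg _ _]mulrC -mulrA mulrC -scalerA IH' //; last first.
  by move=> u s1 s2 p' q' y z; exact: (sth _ (_ :: s1)).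
rewrite !scaler_sumr big_seq [RHS]big_seq; apply: eq_bigr => l lr.
have il : i != l by apply: contraNneq ir => ->.
rewrite (negPf il) /= big_cons.
(* The induction hypothesis has the differentiated letter in front of the tail; it still has to pass
   the head letter [i]. *)
rewrite (koszul_ext_symmetric (podd c) mth sth [::] _ (hDX l) (hX i)).
rewrite (koszul_ext_cons _ _ _ (ha i) (hx i)) // !scalerA.
congr (_ *: _); parity.
Qed.

End PureTensors.

Section Reordering.
Variables (k : fieldType) (A : algType k) (GA : gcalgebra A).
Variables (n : nat) (p d : 'I_n -> int) (a : 'I_n -> A).
Hypotheses (ha : forall i, homog GA (p i) (a i)).

(** Adjacent swaps suffice. Swapping [i] and [j] changes the exponents by
    [(p i + d i) * (p j + d j)], by [d i * d j] and by [d i * p j + d j * p i], and the product by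
    the sign of [p i * p j]; the total is even. *)
Lemma reorder_prod c r r' : perm_eq r r' ->
  (-1) ^ (inv_deg (fun i => p i + d i) r + inv_deg d r + ext_deg p d c r)
     *: \prod_(i <- r) a i =
  (-1) ^ (inv_deg (fun i => p i + d i) r' + inv_deg d r' + ext_deg p d c r')
     *: \prod_(i <- r') a i.
Proof.
pose F r := (-1 : k) ^ (inv_deg (fun i => p i + d i) r + inv_deg d r + ext_deg p d c r)
     *: \prod_(i <- r) a i.
apply: (@swap_invariant_perm _ _ F) => s1 s2 i j ij.
rewrite /F !big_cat !big_cons /= !mulrA -[_ * a i * a j]mulrA (gc_comm (ha i) (ha j)).
rewrite -scalerAr -scalerAl scalerA !mulrA; congr (_ *: _).
rewrite signzD; apply: signz_podd.
rewrite !poddD !(inv_deg_swap _ _ _ ij) !ext_deg_cat /=.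
rewrite [_ + d i + d j]addrAC; move: (ext_deg _ _ _ s2) => E; podd_tauto.
Qed.

End Reordering.

(** * Shuffles as words *)

Section ShuffleWords.

Lemma reshape_index_cons a b i :
  reshape_index (a :: b) i = if (i < a)%N then 0%N else (reshape_index b (i - a)).+1.
Proof.
rewrite /reshape_index /= subn_eq0; case: ltnP => //= ai.
by rewrite subSn.
Qed.

Lemma sorted_reshapeP (T : Type) (leT : rel T) (x0 : T) (b : seq nat) (v : seq T) :
    transitive leT -> size v = sumn b ->
  reflect (forall i j, (i < j < size v)%N -> reshape_index b i = reshape_index b j ->
             leT (nth x0 v i) (nth x0 v j))
          (all (sorted leT) (reshape b v)).
Proof.
move=> tr; elim: b v => [|a b IH] v sv.
  by apply: (iffP idP) => // _ i j; rewrite sv ltn0 andbF.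
have sa : size (take a v) = a by rewrite size_take_min sv /=; apply/minn_idPl/leq_addr.
have sd : size (drop a v) = sumn b by rewrite size_drop sv addKn.
rewrite /=; apply: (iffP andP) => [[s1 /(IH _ sd) s2] i j ij|h].
  rewrite !reshape_index_cons; case: ltnP => ia; case: ltnP => // ja.
    move: s1; rewrite (sorted_pairwise tr) => /(pairwiseP x0) s1 _.
    have := s1 i j; rewrite !inE sa !nth_take //; apply=> //.
    by case/andP: ij.
  case=> e; have := s2 (i - a)%N (j - a)%N; rewrite !nth_drop !subnKC //; apply=> //.
  by rewrite sd; move: sv => /=; lia.
split.
  rewrite (sorted_pairwise tr); apply/(pairwiseP x0) => i j; rewrite !inE sa => ia ja ij.
  rewrite !nth_take //; apply: h; last by rewrite !reshape_index_cons ia ja.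
  by rewrite ij sv /= ltn_addr.
apply/(IH _ sd) => i j ij e; rewrite !nth_drop; apply: h.
  by move: ij; rewrite sd sv /=; lia.
by rewrite !reshape_index_cons !ltnNge !leq_addr /= !addKn e.
Qed.

Variable n : nat.

Definition leI : rel 'I_n := fun i j => (i <= j)%N.

Lemma leI_trans : transitive leI. Proof. by move=> ? ? ?; exact: leq_trans. Qed.
Lemma leI_total : total leI. Proof. by move=> ? ?; exact: leq_total. Qed.
Lemma leI_anti : antisymmetric leI.
Proof. by move=> i j; rewrite /leI -eqn_leq => /eqP/val_inj. Qed.

Lemma sorted_enum_ord : sorted leI (enum 'I_n).
Proof.
rewrite -(@sorted_map _ _ val leq) val_enum_ord.
exact: iota_sorted.
Qed.

Definition word (s : 'S_n) : seq 'I_n := [seq s j | j : 'I_n].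

Lemma nth_word (s : 'S_n) (i : 'I_n) x0 : nth x0 (word s) i = s i.
Proof. by rewrite (nth_map i) ?size_enum_ord // nth_ord_enum. Qed.

End ShuffleWords.

Lemma mem_shuffles n b (s : 'S_n) : sumn b = n ->
  (s \in shuffles n b) = all (sorted (@leI n)) (reshape b (word s)).
Proof.
move=> sb; have sw : size (word s) = sumn b by rewrite size_map size_enum_ord.
rewrite inE; case: n s sb sw => [|m] s sb sw.
  have -> : word s = [::] by apply: size0nil; rewrite sw.
  have -> : all (sorted (@leI 0)) (reshape b [::]) by elim: (b).
  by apply/forallP => -[].
apply/idP/(sorted_reshapeP ord0 (@leI_trans _) sw) => [/forallP h i j|h].
  rewrite sw sb => /andP[ij jm] e.
  have := forallP (h (Ordinal (ltn_trans ij jm))) (Ordinal jm).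
  rewrite /= ij e eqxx /= => /ltnW.
  by rewrite -(nth_word s (Ordinal jm) ord0) -(nth_word s (Ordinal (ltn_trans ij jm)) ord0).
apply/forallP => i; apply/forallP => j; apply/implyP => /andP[ij /eqP e].
have := h i j; rewrite sw sb ij ltn_ord !nth_word => /(_ isT e).
(* Blocks are sorted in the weak sense; strict increase follows from the injectivity of [s]. *)
rewrite /leI leq_eqVlt => /predU1P[/val_inj/perm_inj ijE|//].
by rewrite ijE ltnn in ij.
Qed.

Lemma perm_words n :
  perm_eq [seq word s | s <- index_enum 'S_n] (permutations (enum 'I_n)).
Proof.
apply: uniq_perm; rewrite ?permutations_uniq //.
  rewrite map_inj_uniq ?index_enum_uniq // => s t st; apply/permP => i.
  by rewrite -(nth_word s i i) st nth_word.
move=> r; rewrite mem_permutations; apply/mapP/idP => [[s _ ->]|rE].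
  apply: uniq_perm; rewrite ?enum_uniq //.
    by rewrite map_inj_uniq ?enum_uniq //; exact: perm_inj.
  move=> i; rewrite mem_enum; apply/mapP; exists ((s^-1)%g i); first by rewrite mem_enum.
  by rewrite permKV.
have sr : size r = n by rewrite (perm_size rE) size_enum_ord.
have ur : uniq r by rewrite (perm_uniq rE) enum_uniq.
have fI : injective (fun i : 'I_n => nth i r i).
  move=> i j /eqP; rewrite (set_nth_default i j) ?sr // nth_uniq ?sr // => /eqP.
  exact: val_inj.
exists (perm fI); first exact: mem_index_enum.
case: n r rE sr ur fI => [|n] r rE sr ur fI.
  by apply: etrans (size0nil sr) _; rewrite [word _]size0nil // size_map size_enum_ord.
apply: (@eq_from_nth _ ord0) => [|i ir]; first by rewrite size_map size_enum_ord.
rewrite sr in ir; rewrite -[i]/(val (Ordinal ir)) nth_word permE /=.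
by apply: set_nth_default; rewrite sr.
Qed.

(** Shuffles are handled as lists of values, since the argument cuts them into blocks and moves
    single letters. *)
Definition shuffle_words n (b : seq nat) : seq (seq 'I_n) :=
  [seq r <- permutations (enum 'I_n) | all (sorted (@leI n)) (reshape b r)].

Lemma sum_shuffles (V : zmodType) n b (F : seq 'I_n -> V) : sumn b = n ->
  \sum_(s in shuffles n b) F (word s) = \sum_(r <- shuffle_words n b) F r.
Proof.
move=> sb; rewrite big_filter -(perm_big _ (perm_words n)) big_map /=.
by apply: eq_bigl => s; rewrite mem_shuffles.
Qed.

Lemma mem_shuffle_words n b r : (r \in shuffle_words n b) =
  perm_eq r (enum 'I_n) && all (sorted (@leI n)) (reshape b r).
Proof. by rewrite mem_filter mem_permutations andbC. Qed.

Lemma shuffle_words_uniq n b : uniq (shuffle_words n b).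
Proof. by rewrite filter_uniq // permutations_uniq. Qed.

Lemma shuffle_words2 n i r : (i <= n)%N -> (r \in shuffle_words n [:: i; (n - i)%N]) =
  [&& perm_eq r (enum 'I_n), sorted (@leI n) (take i r) & sorted (@leI n) (drop i r)].
Proof.
move=> le_in; rewrite mem_shuffle_words /=; case: (boolP (perm_eq _ _)) => //= /perm_size sr.
by rewrite andbT [take (n - i) _]take_oversize // size_drop sr size_enum_ord.
Qed.

Lemma shuffle_words_all n b : all (sorted (@leI n)) (reshape b (enum 'I_n)) ->
  (forall r, size r = n -> all (sorted (@leI n)) (reshape b r) -> sorted (@leI n) r) ->
  shuffle_words n b = [:: enum 'I_n].
Proof.
move=> h0 h; apply: perm_small_eq => //; apply: uniq_perm => //.
  exact: shuffle_words_uniq.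
move=> r; rewrite mem_shuffle_words inE; apply/andP/eqP => [[rE rb]|->//].
apply: (sorted_eq (@leI_trans n) (@leI_anti n)) => //; last exact: sorted_enum_ord.
by apply: h => //; rewrite (perm_size rE) size_enum_ord.
Qed.

Lemma shuffle_words_n0 n : shuffle_words n [:: n; 0%N] = [:: enum 'I_n].
Proof.
apply: shuffle_words_all => [|r sr] /=.
  by rewrite take0 take_oversize ?size_enum_ord // sorted_enum_ord.
by rewrite take_oversize ?sr // => /andP[].
Qed.

Lemma shuffle_words_0n n : shuffle_words n [:: 0%N; n] = [:: enum 'I_n].
Proof.
apply: shuffle_words_all => [|r sr] /=.
  by rewrite take0 drop0 take_oversize ?size_enum_ord // sorted_enum_ord.
by rewrite drop0 [take n r]take_oversize ?sr // => /andP[_ /andP[]].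
Qed.

Lemma shuffle_words_0cons n b : shuffle_words n (0%N :: b) = shuffle_words n b.
Proof. by apply: eq_filter => r /=; rewrite take0 drop0. Qed.

(* A (j, 1, n - j - 1)-shuffle is a (j, n - j)-shuffle with one letter of the *)
(* second block moved to the front of that block.                             *)
Lemma sum_shuffles_front (V : zmodType) n j (F : seq 'I_n -> V) : (j < n)%N ->
  \sum_(r <- shuffle_words n [:: j; 1%N; (n - j - 1)%N]) F r =
  \sum_(r <- shuffle_words n [:: j; (n - j)%N]) \sum_(l <- drop j r)
     F (take j r ++ l :: rem l (drop j r)).
Proof.
move=> jn; pose h (r : seq 'I_n) l := take j r ++ l :: rem l (drop j r).
have take_h r l : size r = n -> take j (h r l) = take j r.
  by move=> sr; rewrite take_size_cat // size_takel // sr ltnW.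
have drop_h r l : size r = n -> drop j (h r l) = l :: rem l (drop j r).
  by move=> sr; rewrite drop_size_cat // size_takel // sr ltnW.
have words2 := @shuffle_words2 n j _ (ltnW jn).
have szE r : perm_eq r (enum 'I_n) -> size r = n.
  by move/perm_size; rewrite size_enum_ord.
have sort_eq := sorted_eq (@leI_trans n) (@leI_anti n).
have words3 r : (r \in shuffle_words n [:: j; 1%N; (n - j - 1)%N]) =
    [&& perm_eq r (enum 'I_n), sorted (@leI n) (take j r)
      & sorted (@leI n) (drop j.+1 r)].
  rewrite mem_shuffle_words /=; case: (boolP (perm_eq _ _)) => //= /szE sr.
  rewrite drop_drop add1n andbT [take (n - j - 1) _]take_oversize; last first.
    by rewrite size_drop sr; lia.
  by case: (drop j r) => [|l r'] //=; rewrite take0.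
transitivity (\sum_(r <- [seq h r l | r <- shuffle_words n [:: j; (n - j)%N], l <- drop j r]) F r);
  last by rewrite big_allpairs_dep.
apply: perm_big; apply: uniq_perm; first exact: shuffle_words_uniq.
  apply: allpairs_uniq_dep => [|r|]; first exact: shuffle_words_uniq.
    by rewrite words2 => /andP[/perm_uniq ur _]; rewrite drop_uniq // ur enum_uniq.
  move=> _ _ /allpairsPdep[r1 [l1 [r1w l1r ->]]] /allpairsPdep[r2 [l2 [r2w l2r ->]]] /= e.
  move: r1w r2w; rewrite !words2 => /and3P[/szE s1 _ sd1] /and3P[/szE s2 _ sd2].
  have := congr1 (drop j) e; rewrite !drop_h // => -[ll er].
  have := congr1 (take j) e; rewrite !take_h // => et.
  have rr : r1 = r2.
    rewrite -(cat_take_drop j r1) -(cat_take_drop j r2) et; congr (_ ++ _).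
    apply: sort_eq => //; apply: perm_trans (perm_to_rem l1r) _.
    by rewrite er ll perm_sym perm_to_rem.
  by rewrite rr ll.
move=> r; rewrite words3; apply/and3P/allpairsPdep => [[rE st sd]|[r' [l [r'w lr ->]]]].
  have sr := szE _ rE.
  have [l rl] : exists l, drop j r = l :: drop j.+1 r.
    move: (size_drop j r); rewrite -addn1 addnC -drop_drop.
    case: (drop j r) => [|l r'] /=; last by exists l; rewrite drop0.
    by rewrite sr; lia.
  (* The inverse of [h] sorts the second block again and remembers its former first letter. *)
  have sd' : sorted (@leI n) (sort (@leI n) (drop j r)) by apply: sort_sorted; exact: leI_total.
  exists (take j r ++ sort (@leI n) (drop j r)), l.
  have sj : size (take j r) = j by rewrite size_takel // sr ltnW.
  have lr : l \in sort (@leI n) (drop j r) by rewrite mem_sort rl mem_head.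
  split; rewrite ?words2 ?take_size_cat ?drop_size_cat //.
    rewrite st sd' !andbT; apply: perm_trans rE.
    by rewrite -[X in perm_eq _ X](cat_take_drop j) perm_cat2l perm_sort.
  rewrite /h take_size_cat // drop_size_cat // -{1}(cat_take_drop j r) rl.
  congr (_ ++ _ :: _); apply: sort_eq => //.
    by rewrite -rl; exact: (subseq_sorted (@leI_trans n) (rem_subseq _ _) sd').
  rewrite -rl -(perm_cons l) -{1}rl.
  by apply: perm_trans (perm_to_rem lr); rewrite perm_sym perm_sort.
move: r'w; rewrite words2 => /and3P[r'E st sd]; have sr := szE _ r'E.
split.
- apply: perm_trans r'E; rewrite -[X in perm_eq _ X](cat_take_drop j) /h perm_cat2l.
  by rewrite perm_sym perm_to_rem.
- by rewrite take_h.
- rewrite -addn1 addnC -drop_drop drop_h //= drop0.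
  exact: (subseq_sorted (@leI_trans n) (rem_subseq _ _) sd).
Qed.

(** * Reduction to homogeneous pure tensors *)

Section MultilinearFamilies.
Variables (k : fieldType) (V W : lmodType k) (n : nat).

Definition update (x : 'I_n -> V) i v : 'I_n -> V :=
  fun j => if j == i then v else x j.

Definition multilinear_fam (f : ('I_n -> V) -> W) := forall x i c u v,
  f (update x i (c *: u + v)) = c *: f (update x i u) + f (update x i v).

Inductive lin_span (S : V -> Prop) : V -> Prop :=
| LinSpan0 : lin_span S 0
| LinSpanP c u v : lin_span S u -> lin_span S v -> lin_span S (c *: u + v)
| LinSpanIn u : S u -> lin_span S u.

(** Arguments are reduced from spans to generators one at a time; [m] counts the leading positions
    that are not yet reduced. *)
Lemma multilinear_fam_span (P : W -> Prop) (f : ('I_n -> V) -> W)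
    (S : 'I_n -> V -> Prop) :
    P 0 -> (forall c u v, P u -> P v -> P (c *: u + v)) -> multilinear_fam f ->
    (forall x, (forall i, S i (x i)) -> P (f x)) ->
  forall x, (forall i, lin_span (S i) (x i)) -> P (f x).
Proof.
move=> P0 PP mf hS.
suff gen m : forall x, (forall i, lin_span (S i) (x i)) ->
    (forall i : 'I_n, (m <= i)%N -> S i (x i)) -> P (f x).
  by move=> x hx; apply: (gen n) => // i; rewrite leqNgt ltn_ord.
elim: m => [|m IH] x hx hm; first by apply: hS => i; exact: hm.
have [mn|nm] := ltnP m n; last first.
  by apply: IH => // i mi; have := ltn_ord i; rewrite ltnNge (leq_trans nm mi).
pose i := Ordinal mn.
have xE : x = update x i (x i).
  by apply/funext => j; rewrite /update; case: eqP => // ->.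
rewrite xE; elim: (hx i) => [|c u v _ hu _ hv|u hu].
- have := mf x i (-1) 0 0; rewrite scaler0 addr0 scaleN1r addNr => ->.
  exact: P0.
- by rewrite mf; exact: PP.
apply: IH => j; rewrite /update; case: eqP => [->|/eqP ji] //; first exact: LinSpanIn.
move=> mj; apply: hm; rewrite ltn_neqAle mj andbT.
by move: ji; rewrite -val_eqE /= eq_sym.
Qed.

Lemma multilinear_famP c f h : multilinear_fam f -> multilinear_fam h ->
  multilinear_fam (fun x => c *: f x + h x).
Proof. by move=> mf mh x i z u v; rewrite mf mh scale_comb_swap. Qed.

Lemma multilinear_famD f h : multilinear_fam f -> multilinear_fam h ->
  multilinear_fam (fun x => f x + h x).
Proof. by move=> mf mh x i z u v; rewrite mf mh scalerDr addrACA. Qed.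

Lemma multilinear_famZ c f : multilinear_fam f -> multilinear_fam (fun x => c *: f x).
Proof.
by move=> mf x i z u v; rewrite mf scalerDr !scalerA mulrC.
Qed.

Lemma multilinear_fam_sum I (r : seq I) (P : pred I) (f : I -> ('I_n -> V) -> W) :
    (forall i, multilinear_fam (f i)) ->
  multilinear_fam (fun x => \sum_(i <- r | P i) f i x).
Proof.
move=> mf x i z u v; rewrite scaler_sumr -big_split /=.
by apply: eq_bigr => j _; rewrite mf.
Qed.

Lemma multilinear_fam_word (F : seq V -> W) (r : seq 'I_n) :
    multilinear F -> perm_eq r (enum 'I_n) ->
  multilinear_fam (fun x => F [seq x i | i <- r]).
Proof.
move=> mF rE x i c u v.
have ur : uniq r by rewrite (perm_uniq rE) enum_uniq.
have ir : i \in r by rewrite (perm_mem rE) mem_enum.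
case/splitPr: ir ur => r1 r2; rewrite cat_uniq /= negb_or => /and4P[_ /andP[i1 _] i2 _].
have out w s : i \notin s -> [seq update x i w j | j <- s] = [seq x j | j <- s].
  move=> is_; apply/eq_in_map => j js; rewrite /update; case: eqP => // ji.
  by rewrite -ji js in is_.
have at_i w : update x i w i = w by rewrite /update eqxx.
by rewrite !map_cat !map_cons !out // !at_i mF.
Qed.

End MultilinearFamilies.

Section MultilinearSplit.
Variables (k : fieldType) (V W : lmodType k).

Lemma multilinear_take_drop (B : seq V -> seq V -> W) j :
    (forall ys, multilinear (B^~ ys)) -> (forall xs, multilinear (B xs)) ->
  multilinear (fun xs => B (take j xs) (drop j xs)).
Proof.
move=> ml mr s1 s2 c x y; rewrite !take_cat !drop_cat.
case: ltnP => [_|sj]; first exact: mr.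
case: (j - size s1)%N => [|m] /=; first by rewrite !cats0; exact: (mr _ [::]).
exact: ml.
Qed.

Lemma multilinear_cons (W' : lmodType k) (F : seq W' -> W) (f : seq V -> W') ys :
  multilinear F -> multilinear f -> multilinear (fun xs => F (f xs :: ys)).
Proof. by move=> mF mf s1 s2 c x y; rewrite mf; exact: (mF [::]). Qed.

Lemma multilinear_cons_tail (F : seq V -> W) z :
  multilinear F -> multilinear (fun xs => F (z :: xs)).
Proof. by move=> mF s1 s2 c x y; exact: (mF (z :: s1)). Qed.

End MultilinearSplit.

Section HomogeneousSpans.
Variables (k : fieldType).

Lemma homog_lin_span (V : lmodType k) (G : grading V) v :
  lin_span (fun u => exists d, homog G d u) v.
Proof.
have [n [d [c [hc ->]]]] := homog_span G v; elim: n d c hc => [|n IH] d c hc.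
  by rewrite big_ord0; exact: LinSpan0.
rewrite big_ord_recl -[c ord0]scale1r; apply: LinSpanP.
  by apply: LinSpanIn; exists (d ord0).
exact: (IH (fun i => d (fintype.lift ord0 i))).
Qed.

Variables (U V : lmodType k) (GU : grading U) (GV : grading V).

(** The degrees of the factors may vary between the summands of a homogeneous tensor; only their sum
    is fixed, and Koszul signs of tensors depend on that sum alone. *)
Definition pure_homog n (t : tensor U V) := exists p q u v,
  [/\ homog GU p u, homog GV q v, p + q = n & t = u ⊗ v].

Lemma tensor_homog_lin_span n t :
  tensor_homog GU GV n t -> lin_span (pure_homog n) t.
Proof.
elim=> [|c s u _ hs _ hu|p q u v hu hv e]; first exact: LinSpan0.
  exact: LinSpanP.
by apply: LinSpanIn; exists p, q, u, v.
Qed.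

End HomogeneousSpans.

(** * Koszul signs and tensor signs as exponents of words *)

Section SignsOfWords.
Variable k : fieldType.

Lemma signz_sum I (r : seq I) (P : pred I) (F : I -> int) :
  (-1) ^ (\sum_(i <- r | P i) F i) = \prod_(i <- r | P i) (-1) ^ F i :> k.
Proof. by apply: big_morph => // x y; rewrite signzD. Qed.

Lemma map_word (T : Type) n (x : 'I_n -> T) (s : 'S_n) :
  [seq x (s h) | h : 'I_n] = map x (word s).
Proof. by rewrite /word /image_mem -(map_comp x s). Qed.

Lemma koszul_word n (d : 'I_n -> int) (s : 'S_n) :
  koszul k d s = (-1) ^ inv_deg d (word s).
Proof.
rewrite /koszul /word.
(* Removing the first letter of a permutation leaves no permutation, so the induction runs over
   arbitrary maps. *)
have gen m (f : 'I_m -> 'I_n) :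
    \prod_(i < m) \prod_(j < m | (i < j)%N && (f j < f i)%N) (-1) ^ (d (f i) * d (f j))
    = (-1) ^ inv_deg d [seq f j | j : 'I_m] :> k.
  elim: m f => [|m IH] f; first by rewrite big_ord0 /image_mem enum_ord0.
  rewrite /image_mem enum_ordSl /= -map_comp big_ord_recl -signzD; congr (_ * _).
    rewrite big_mkcond big_ord_recl /= mul1r big_map mulr_sumr signz_sum.
    by rewrite big_enum_cond /= [RHS]big_mkcond /=.
  rewrite -[[seq _ | _ <- _]]/(image (f \o fintype.lift ord0) _) -IH.
  apply: eq_bigr => i _; rewrite big_mkcond big_ord_recl /= mul1r [RHS]big_mkcond /=.
  by apply: eq_bigr => j _; rewrite /bump /= !add1n ltnS.
exact: gen.
Qed.

Lemma sum_take_word n (d : 'I_n -> int) (s : 'S_n) m :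
  \sum_(h < n | (h < m)%N) d (s h) = \sum_(i <- take m (word s)) d i.
Proof.
rewrite /word.
have gen q (f : 'I_q -> 'I_n) m' : \sum_(h < q | (h < m')%N) d (f h)
    = \sum_(i <- take m' [seq f j | j : 'I_q]) d i.
  elim: q f m' => [|q IH] f m'; first by rewrite big_ord0 /image_mem enum_ord0 big_nil.
  rewrite /image_mem enum_ordSl /= -map_comp big_mkcond big_ord_recl /=.
  case: m' => [|m'] /=; first by rewrite add0r big1 ?big_nil.
  rewrite big_cons -[[seq _ | _ <- _]]/(image (f \o fintype.lift ord0) _) -IH.
  by rewrite [in RHS]big_mkcond.
exact: gen.
Qed.

Lemma ext_deg_enum n (p d : 'I_n -> int) c :
  \sum_(i < n) (c + \sum_(j < n | (j < i)%N) d j) * p i = ext_deg p d c (enum 'I_n).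
Proof.
have ext_deg_map m (f : 'I_m -> 'I_n) c' r :
    ext_deg p d c' (map f r) = ext_deg (p \o f) (d \o f) c' r.
  by elim: r c' => //= i r IH c'; rewrite IH.
rewrite -[enum _]map_id.
have gen m (f : 'I_m -> 'I_n) c' :
    \sum_(i < m) (c' + \sum_(j < m | (j < i)%N) d (f j)) * p (f i)
    = ext_deg p d c' [seq f j | j : 'I_m].
  elim: m f c' => [|m IH] f c'; first by rewrite big_ord0 /image_mem enum_ord0.
  rewrite /image_mem enum_ordSl /= -map_comp big_ord_recl big_pred0 // addr0.
  congr (_ + _).
  rewrite -[[seq _ | _ <- _]]/(image (f \o fintype.lift ord0) _) -IH.
  apply: eq_bigr => i _; rewrite -addrA; congr ((_ + _) * _).
  by rewrite big_mkcond big_ord_recl /= [in RHS]big_mkcond.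
exact: (gen n id).
Qed.

Lemma tensor_sign_enum n (p d : 'I_n -> int) :
  tensor_sign k p d = (-1) ^ ext_deg p d 1 (enum 'I_n).
Proof. by rewrite /tensor_sign ext_deg_enum. Qed.

Lemma sum_shuffles_koszul (V W : lmodType k) n (d : 'I_n -> int) (x : 'I_n -> V) b
    (F : seq V -> W) : sumn b = n ->
  \sum_(s in shuffles n b) koszul k d s *: F [seq x (s h) | h : 'I_n] =
  \sum_(r <- shuffle_words n b) (-1) ^ inv_deg d r *: F [seq x i | i <- r].
Proof.
move=> sb; rewrite -sum_shuffles //; apply: eq_bigr => s _.
by rewrite koszul_word map_word.
Qed.

End SignsOfWords.
Arguments inv_deg {n} e r : simpl never.
Arguments ext_deg {I} p d c r : simpl never.

Section IndexedLists.
Variables (k : fieldType) (A : algType k) (GA : gcalgebra A).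
Variables (g : lmodType k) (G : grading g) (l : linfty G) (dA : differential GA).
Variable (R : linfty_action l dA).

Lemma map_tnth_seq (S T : Type) (x : S -> T) (r : seq S) :
  [seq x (tnth (in_tuple r) i) | i : 'I_(size r)] = map x r.
Proof. by rewrite /image_mem (map_comp x) map_tnth_enum. Qed.

Lemma bracket_degree_seq (I : eqType) (r : seq I) (d : I -> int) (x : I -> g) :
  (0 < size r)%N -> (forall i, homog G (d i) (x i)) ->
  homog G (\sum_(i <- r) d i + 1) (l [seq x i | i <- r]).
Proof.
move=> r0 hx; have := @bracket_degree _ _ _ l _ (d \o tnth (in_tuple r))
  (x \o tnth (in_tuple r)) r0 (fun i => hx _).
rewrite [X in _ -> homog _ (X + _) _]big_tnth; congr (homog G _ (l _)).
exact: map_tnth_seq.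
Qed.

Lemma rho_derivation_seq (I : eqType) (r : seq I) (d : I -> int) (x : I -> g) :
  (0 < size r)%N -> (forall i, homog G (d i) (x i)) ->
  derivation GA (\sum_(i <- r) d i + 1) (R [seq x i | i <- r]).
Proof.
move=> r0 hx; have := @rho_derivation _ _ _ _ _ _ _ R _ (d \o tnth (in_tuple r))
  (x \o tnth (in_tuple r)) r0 (fun i => hx _).
rewrite [X in _ -> derivation _ (X + _) _]big_tnth; congr (derivation GA _ (R _)).
exact: map_tnth_seq.
Qed.

(* [R [::]] is unconstrained, so it is replaced by [0]. *)
Definition rho0 (xs : seq g) (b : A) : A := if xs is [::] then 0 else R xs b.

Lemma rho0_multilinear b : multilinear (rho0^~ b).
Proof. by move=> [|? ?] s2 c x y; exact: (rho_multilinear R b). Qed.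

Lemma rho0_symmetric b : graded_symmetric G (rho0^~ b).
Proof. by move=> [|? ?] s2 p q x y; exact: (rho_symmetric R b). Qed.

Lemma rho0_derivation (I : eqType) (r : seq I) (d : I -> int) (x : I -> g) :
  (0 < size r)%N -> (forall i, homog G (d i) (x i)) ->
  derivation GA (\sum_(i <- r) d i + 1) (rho0 [seq x i | i <- r]).
Proof. by case: r => // i r r0 hx; exact: rho_derivation_seq. Qed.

(** The action provides linearity for homogeneous letters only. The defect of linearity is
    multilinear in the letters, hence vanishes on all of them. *)
Lemma rho0_linear xs : linear (rho0 xs).
Proof.
case: (posnP (size xs)) => [/size0nil -> c u v|xs0 c u v].
  by rewrite /= scaler0 addr0.
pose f (x : 'I_(size xs) -> g) :=
  rho0 [seq x i | i <- enum 'I_(size xs)] (c *: u + v)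
  - (c *: rho0 [seq x i | i <- enum 'I_(size xs)] u
     + rho0 [seq x i | i <- enum 'I_(size xs)] v).
have mf : multilinear_fam f.
  have mr b : multilinear_fam (fun x => rho0 [seq x i | i <- enum 'I_(size xs)] b).
    apply: (multilinear_fam_word (F := rho0^~ b)) => //; exact: rho0_multilinear.
  have mc := multilinear_famP (-1) (multilinear_famP c (mr u) (mr v)) (mr (c *: u + v)).
  by move=> x i z y y'; have := mc x i z y y'; rewrite !scaleN1r /f ![- _ + _]addrC.
have f0 x : f x = 0.
  pose S (i : 'I_(size xs)) u := exists d, homog G d u.
  apply: (@multilinear_fam_span _ _ _ _ (fun w => w = 0) f S) => //.
  - by move=> z w w' -> ->; rewrite scaler0 addr0.
  - move=> y hy; have [d hd] := choice hy.
    rewrite /f (derivation_linear (rho0_derivation _ hd)) ?subrr //.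
    by rewrite size_enum_ord.
  - by move=> i; exact: homog_lin_span.
apply/eqP; rewrite -subr_eq0; apply/eqP.
have := f0 (tnth (in_tuple xs)).
rewrite /f (_ : [seq _ | _ <- _] = xs) //; exact: map_tnth_enum.
Qed.

End IndexedLists.

(** * The operations on A ⊗ g *)

Section TensorMaps.
Variables (k : fieldType) (A : algType k) (g : lmodType k).

Definition tens_map (D : A -> A) : tensor A g -> tensor A g :=
  tlift (fun b y => D b ⊗ y).

Lemma tens_map_bilinear (D : A -> A) : linear D ->
  bilinear_fun (fun b (y : g) => D b ⊗ y).
Proof.
move=> Dl; split=> [y|b] z u v; first by rewrite Dl tens_linearl.
exact: tens_linearr.
Qed.

Lemma tens_mapE D b y : linear D -> tens_map D (b ⊗ y) = D b ⊗ y.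
Proof. by move=> Dl; rewrite /tens_map tliftE //; exact: tens_map_bilinear. Qed.

Lemma tens_map_linear D : linear (tens_map D).
Proof. exact: tlift_linear. Qed.

Lemma tens_map_comb z D1 D2 D t : linear D1 -> linear D2 ->
  (forall b, D b = z *: D1 b + D2 b) ->
  tens_map D t = z *: tens_map D1 t + tens_map D2 t.
Proof.
move=> l1 l2 DE; rewrite /tens_map -tlift_comb; try exact: tens_map_bilinear.
congr (tlift _ t); apply/funext => b; apply/funext => y.
by rewrite DE tens_linearl.
Qed.

Lemma tens_mapZ z D1 D t : linear D1 -> (forall b, D b = z *: D1 b) ->
  tens_map D t = z *: tens_map D1 t.
Proof.
move=> l1 DE; have l0 : linear (fun _ : A => 0 : A) by move=> c u v; rewrite scaler0 addr0.
have t0 : tens_map (fun _ : A => 0 : A) t = 0.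
  by rewrite (@tens_map_comb (-1) _ _ _ t l0 l0) ?scaleN1r ?addNr // scaler0 addr0.
by rewrite -[RHS]addr0 -t0; apply: tens_map_comb => // b; rewrite addr0.
Qed.

End TensorMaps.

Section PostLie.
Variables (k : fieldType) (A : algType k) (GA : gcalgebra A).
Variables (g : lmodType k) (G : grading g) (l : linfty G).
Variable (R : linfty_action l (zero_differential GA)).
Local Notation T := (tensor A g).
Local Notation GT := (tensor_grading GA G).

Definition bracket_theta (u : A) (xs : seq g) : T := u ⊗ l xs.
Definition rho_theta (b u : A) (xs : seq g) : A := u * rho0 R xs b.

Lemma bracket_theta_multilinear : multilinear_on bracket_theta.
Proof.
split=> [xs|a s1 s2 z x y]; first exact: tens_linearl.
by rewrite /bracket_theta (bracket_multilinear l) tens_linearr.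
Qed.

Lemma bracket_theta_symmetric u : graded_symmetric G (bracket_theta u).
Proof.
move=> s1 s2 p q x y hx hy.
by rewrite /bracket_theta (bracket_symmetric l _ _ hx hy) (linear_funZ (tens_linearr u)).
Qed.

Lemma rho_theta_multilinear b : multilinear_on (rho_theta b).
Proof.
split=> [xs z u v|a s1 s2 z x y]; first by rewrite /rho_theta mulrDl scalerAl.
by rewrite /rho_theta (@rho0_multilinear _ _ _ _ _ _ _ R b) mulrDr scalerAr.
Qed.

Lemma rho_theta_symmetric b u : graded_symmetric G (rho_theta b u).
Proof.
move=> s1 s2 p q x y hx hy.
by rewrite /rho_theta (@rho0_symmetric _ _ _ _ _ _ _ R b _ _ _ _ _ _ hx hy) scalerAr.
Qed.

Definition rho_ext (xs : seq T) (b : A) : A :=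
  koszul_ext GA G (podd 1) (rho_theta b) xs.

Definition bracket_ext (xs : seq T) : T :=
  koszul_ext GA G (podd 1) bracket_theta xs.

Lemma rho_ext_linear xs : linear (rho_ext xs).
Proof.
move=> z u v; rewrite /rho_ext -koszul_ext_comb; try exact: rho_theta_multilinear.
congr (koszul_ext _ _ _ _ xs); apply/funext => a; apply/funext => ys.
by rewrite /theta_comb /rho_theta rho0_linear mulrDr scalerAr.
Qed.

Lemma rho_ext_multilinear b : multilinear (rho_ext^~ b).
Proof.
by move=> s1 s2 c x y; apply: koszul_ext_multilinear; exact: rho_theta_multilinear.
Qed.

Lemma rho_ext_symmetric b : graded_symmetric GT (rho_ext^~ b).
Proof.
move=> s1 s2 p q x y; apply: koszul_ext_symmetric; first exact: rho_theta_multilinear.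
exact: rho_theta_symmetric.
Qed.

Lemma bracket_ext_multilinear : multilinear bracket_ext.
Proof. by apply: koszul_ext_multilinear; exact: bracket_theta_multilinear. Qed.

Lemma bracket_ext_symmetric : graded_symmetric GT bracket_ext.
Proof.
apply: koszul_ext_symmetric; first exact: bracket_theta_multilinear.
exact: bracket_theta_symmetric.
Qed.

Definition plie (xs ys : seq T) : T :=
  match xs, ys with
  | [::], _ => bracket_ext ys
  | _ :: _, [:: t] => tens_map (rho_ext xs) t
  | _ :: _, _ => 0
  end.

Lemma plie_rho xs t : (0 < size xs)%N -> plie xs [:: t] = tens_map (rho_ext xs) t.
Proof. by case: xs. Qed.

Lemma plie0 xs ys : (0 < size xs)%N -> (1 < size ys)%N -> plie xs ys = 0.
Proof. by case: xs => // x xs _; case: ys => [|y []]. Qed.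

Lemma plie_multilinearl ys : multilinear (plie^~ ys).
Proof.
move=> s1 s2 c x y; case: ys => [|t [|t' ys]].
- by case: s1 => [|z s1]; rewrite /= scaler0 addr0.
- rewrite !plie_rho ?size_cat ?addnS //; apply: tens_map_comb.
  1,2: exact: rho_ext_linear.
  by move=> b; exact: rho_ext_multilinear.
- by case: s1 => [|z s1]; rewrite /= scaler0 addr0.
Qed.

Lemma plie_multilinearr xs : multilinear (plie xs).
Proof.
case: xs => [|z xs]; first exact: bracket_ext_multilinear.
case=> [|y0 [|y1 s1]] [|y2 s2] c x y; rewrite /= ?scaler0 ?addr0 //.
exact: tlift_linear.
Qed.

Lemma plie_symmetricl ys : graded_symmetric GT (plie^~ ys).
Proof.
move=> s1 s2 p q x y hx hy; case: ys => [|t [|t' ys]].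
- by case: s1 => [|z s1]; rewrite /= scaler0.
- rewrite !plie_rho ?size_cat ?addnS //; apply: tens_mapZ; first exact: rho_ext_linear.
  by move=> b; exact: rho_ext_symmetric.
- by case: s1 => [|z s1]; rewrite /= scaler0.
Qed.

Lemma plie_symmetricr xs : graded_symmetric GT (plie xs).
Proof.
case: xs => [|z xs]; first exact: bracket_ext_symmetric.
by case=> [|y0 [|y1 s1]] s2 p q x y hx hy; rewrite /= scaler0.
Qed.

Section Pure.
Variables (I : eqType) (p d : I -> int) (a : I -> A) (x : I -> g).
Hypotheses (ha : forall i, homog GA (p i) (a i)).
Hypotheses (hx : forall i, homog G (d i) (x i)).
Local Notation X i := (a i ⊗ x i).

Lemma bracket_ext_pure r : bracket_ext [seq X i | i <- r] =
  (-1) ^ ext_deg p d 1 r *: ((\prod_(i <- r) a i) ⊗ l [seq x i | i <- r]).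
Proof. exact: (koszul_ext_pure ha hx _ _ bracket_theta_multilinear). Qed.

Lemma rho_ext_pure r b : rho_ext [seq X i | i <- r] b =
  (-1) ^ ext_deg p d 1 r *: (\prod_(i <- r) a i * rho0 R [seq x i | i <- r] b).
Proof. exact: (koszul_ext_pure ha hx _ _ (rho_theta_multilinear b)). Qed.

(** Up to sign the map is a coefficient times a derivation, which is again a derivation since [A] is
    graded commutative. This allows the Leibniz rule to be applied to the extended anchor itself. *)
Lemma rho_ext_derivation r : (0 < size r)%N ->
  derivation GA (\sum_(i <- r) (p i + d i) + 1) (rho_ext [seq X i | i <- r]).
Proof.
move=> r0; have hD := rho0_derivation R r0 hx.
split=> [|q b hb|q b c hb]; first exact: rho_ext_linear.
  rewrite rho_ext_pure; apply: homogZ.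
  have := gc_mul (homog_prod ha r) (derivation_degree hD hb).
  by rewrite big_split /= !addrA.
rewrite !rho_ext_pure (derivation_leibniz hD _ hb) mulrDr scalerDr.
rewrite -!scalerAl -!mulrA -!scalerAr !scalerA; congr (_ + _).
rewrite [in RHS]mulrA (gc_comm hb (homog_prod ha r)) -scalerAl scalerA mulrA.
rewrite big_split /=; congr (_ *: _).
move: (\sum_(i <- r) p i) (\sum_(i <- r) d i) => P Q; parity.
Qed.

End Pure.
End PostLie.
Arguments plie {k A GA g G l} R xs ys : simpl never.
Arguments bracket_ext {k A} GA {g G} l xs.

(** * The post-Lie relations *)

Section PureRelations.
Variables (k : fieldType) (A : algType k) (GA : gcalgebra A).
Variables (g : lmodType k) (G : grading g) (l : linfty G).
Variable (R : linfty_action l (zero_differential GA)).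
Variables (n : nat) (p d : 'I_n -> int) (a : 'I_n -> A) (x : 'I_n -> g).
Hypotheses (ha : forall i, homog GA (p i) (a i)).
Hypotheses (hx : forall i, homog G (d i) (x i)).

Local Notation e := (fun i => p i + d i).
Local Notation pts r := [seq a i ⊗ x i | i <- r].
Local Notation words := (shuffle_words n).

(** The common multiple carried by all undifferentiated terms. The symbol degree is [0] because in
    each such term a coefficient passes two operations of degree 1, whose contributions cancel. *)
Definition signed_prod : A :=
  (-1) ^ ext_deg p d 0 (enum 'I_n) *: \prod_(i <- enum 'I_n) a i.

Lemma reorder_signed_prod r : perm_eq r (enum 'I_n) ->
  (-1) ^ inv_deg e r *: ((-1) ^ ext_deg p d 0 r *: \prod_(i <- r) a i) =
  (-1) ^ inv_deg d r *: signed_prod.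
Proof.
move=> rE; have := reorder_prod d ha 0 rE.
rewrite !(inv_deg_sorted _ (sorted_enum_ord n)) !add0r -/signed_prod => <-.
by rewrite !scalerA; congr (_ *: _); parity.
Qed.

Lemma koszul_ext_head (W : lmodType k) (th : A -> seq g -> W) P Q (b : A) (y : g) r :
    multilinear_on th -> homog GA P b -> homog G Q y ->
  koszul_ext GA G (podd 1) th (b ⊗ y :: pts r) =
  (-1) ^ (P + ext_deg p d (1 + Q) r) *: th (b * \prod_(i <- r) a i) (y :: [seq x i | i <- r]).
Proof.
move=> mth hb hy; rewrite (koszul_ext_cons _ _ _ hb hy) // (koszul_ext_pure ha hx).
  by rewrite scalerA signzD mul1r.
exact: multilinear_on_prepend.
Qed.

Lemma words_perm b r : r \in words b -> perm_eq r (enum 'I_n).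
Proof. by rewrite mem_shuffle_words => /andP[]. Qed.

Lemma words_size b r : r \in words b -> size r = n.
Proof. by move/words_perm/perm_size; rewrite size_enum_ord. Qed.

(** Stated for a general [th] so that it serves both the Jacobi identity, with [bracket_theta], and
    the action identity, with [rho_theta]. *)
Lemma koszul_ext_bracket (W : lmodType k) (th : A -> seq g -> W) i r :
    multilinear_on th -> perm_eq r (enum 'I_n) -> (0 < i <= n)%N ->
  (-1) ^ inv_deg e r *:
    koszul_ext GA G (podd 1) th (bracket_ext GA l (pts (take i r)) :: pts (drop i r)) =
  (-1) ^ inv_deg d r *:
    th signed_prod (l [seq x j | j <- take i r] :: [seq x j | j <- drop i r]).
Proof.
move=> mth rE /andP[i0 iN].
have t0 : (0 < size (take i r))%N.
  by rewrite size_takel // (perm_size rE) size_enum_ord.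
rewrite (bracket_ext_pure l ha hx).
rewrite koszul_ext_consZ (koszul_ext_head _ mth (homog_prod ha _) (bracket_degree_seq l t0 hx)).
rewrite -!(linear_funZ (mth.1 _)) -reorder_signed_prod //; congr (th _ _).
rewrite -big_cat cat_take_drop !scalerA; congr (_ *: _).
rewrite -[in ext_deg p d 0 r](cat_take_drop i r) ext_deg_cat.
rewrite !ext_degD !ext_deg1; parity.
Qed.

Lemma bracket_ext_jacobi : (0 < n)%N ->
  \sum_(1 <= i < n.+1) \sum_(r <- words [:: i; (n - i)%N])
    (-1) ^ inv_deg e r *: bracket_ext GA l (bracket_ext GA l (pts (take i r)) :: pts (drop i r)) = 0.
Proof.
move=> n0; transitivity (signed_prod ⊗ \sum_(1 <= i < n.+1)
    \sum_(r <- words [:: i; (n - i)%N]) (-1) ^ inv_deg d r *: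
      l (l [seq x j | j <- take i r] :: [seq x j | j <- drop i r])).
  rewrite (linear_fun_sum (tens_linearr _)) !big_nat; apply: eq_bigr => i iP.
  rewrite (linear_fun_sum (tens_linearr _)) !big_seq; apply: eq_bigr => r /words_perm rE.
  rewrite (koszul_ext_bracket (bracket_theta_multilinear A l)) //.
  by rewrite (linear_funZ (tens_linearr _)).
rewrite -[RHS](linear_fun0 (tens_linearr signed_prod)); congr (_ ⊗ _).
apply: etrans (bracket_jacobi l n0 hx); rewrite !big_nat; apply: eq_bigr => i /andP[_ iN].
have sb : sumn [:: i; (n - i)%N] = n by rewrite /= addn0 subnKC.
rewrite (sum_shuffles_koszul d x (fun xs => l (l (take i xs) :: drop i xs)) sb).
by apply: eq_bigr => r _; rewrite map_take map_drop.
Qed.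

Lemma bracket_ext_derivation delta (D : A -> A) : derivation GA delta D -> (0 < n)%N ->
  \sum_(r <- words [:: 1%N; (n - 1)%N]) (-1) ^ inv_deg e r *:
    bracket_ext GA l ([seq tens_map D t | t <- pts (take 1 r)] ++ pts (drop 1 r)) =
  (-1) ^ delta *: tens_map D (bracket_ext GA l (pts (enum 'I_n))).
Proof.
move=> hD n0.
(* For an empty first block, choosing the letter hit by [D] is the same as a [(1, n - 1)]-shuffle,
   and the only word left to differentiate is the sorted one. *)
have := sum_shuffles_front (fun r => (-1) ^ inv_deg e r *:
    bracket_ext GA l ([seq tens_map D t | t <- pts (take 1 r)] ++ pts (drop 1 r))) n0.
rewrite subn0 shuffle_words_0cons => ->.
rewrite shuffle_words_0n big_seq1 drop0 take0 /=.
rewrite (bracket_ext_pure l ha hx) (linear_funZ (tens_map_linear _)).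
rewrite tens_mapE; last exact: derivation_linear hD.
have := koszul_ext_leibniz ha hx 1 hD (bracket_theta_multilinear A l)
  (bracket_theta_symmetric l) (enum_uniq _).
rewrite {1}/bracket_theta => ->; rewrite scalerA signzD mulr1 signz_even ?scale1r; last first.
  by rewrite poddD addbb.
apply: eq_big_seq => i ir; rewrite take0 drop0.
rewrite (inv_deg_front _ (sorted_enum_ord n) (enum_uniq _) ir) /=.
by rewrite tens_mapE //; exact: derivation_linear hD.
Qed.

Lemma rho_ext_action b : (0 < n)%N ->
  \sum_(1 <= i < n.+1) \sum_(r <- words [:: i; (n - i)%N])
    (-1) ^ inv_deg e r *: rho_ext R (bracket_ext GA l (pts (take i r)) :: pts (drop i r)) b
  + \sum_(1 <= i < n) \sum_(r <- words [:: i; (n - i)%N])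
      (-1) ^ (inv_deg e r + \sum_(j <- take i r) e j) *:
         rho_ext R (pts (take i r)) (rho_ext R (pts (drop i r)) b)
  + \sum_(1 <= i < n) \sum_(r <- words [:: i; 1%N; (n - i - 1)%N])
      (-1) ^ inv_deg e r *:
        rho_ext R ([seq tens_map (rho_ext R (pts (take i r))) t | t <- pts (take 1 (drop i r))]
          ++ pts (drop i.+1 r)) b = 0.
Proof.
move=> n0.
have signZ (z : int) w : (-1) ^ (z + 1) *: w = - ((-1) ^ z *: w) :> A.
  by rewrite -signzNr scaleNr.
have sz i (r : seq 'I_n) : (0 < i < n)%N -> size r = n ->
    (0 < size (take i r))%N /\ (0 < size (drop i r))%N.
  by move=> /andP[i0 iN] sr; rewrite size_takel ?size_drop sr ?subn_gt0 // ltnW.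
pose rho2 i r := rho0 R [seq x j | j <- take i r] (rho0 R [seq x j | j <- drop i r] b).
(* The nested terms of the third sum take the shape of a Leibniz expansion over the second block. *)
have moved i : (0 < i < n)%N ->
    \sum_(r <- words [:: i; 1%N; (n - i - 1)%N]) (-1) ^ inv_deg e r *:
      rho_ext R ([seq tens_map (rho_ext R (pts (take i r))) t | t <- pts (take 1 (drop i r))]
        ++ pts (drop i.+1 r)) b =
    \sum_(r <- words [:: i; (n - i)%N]) \sum_(j <- drop i r)
      (-1) ^ (inv_deg e r + e j * \sum_(h <- take (index j (drop i r)) (drop i r)) e h) *:
      rho_ext R (rho_ext R (pts (take i r)) (a j) ⊗ x j :: pts (rem j (drop i r))) b.
  move=> /andP[i0 iN].
  rewrite (sum_shuffles_front (fun r => (-1) ^ inv_deg e r *: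
      rho_ext R ([seq tens_map (rho_ext R (pts (take i r))) t | t <- pts (take 1 (drop i r))]
        ++ pts (drop i.+1 r)) b) iN).
  apply: eq_big_seq => r rw; apply: eq_big_seq => j jr.
  have sr := words_size rw; move: rw; rewrite shuffle_words2 ?(ltnW iN) // => /and3P[rE _ sd].
  have st : size (take i r) = i by rewrite size_takel // sr ltnW.
  rewrite take_size_cat // drop_size_cat // -cat_rcons drop_size_cat ?size_rcons ?st //.
  rewrite cat_rcons /= take0 /= tens_mapE; last exact: rho_ext_linear.
  have ud : uniq (drop i r) by rewrite drop_uniq // (perm_uniq rE) enum_uniq.
  have jrE : perm_eq (j :: rem j (drop i r)) (drop i r) by rewrite perm_sym perm_to_rem.
  rewrite (inv_deg_cat e _ jrE) cat_take_drop (inv_deg_front _ sd ud jr).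
  by rewrite (inv_deg_sorted _ sd) subr0.
(* The outer anchor hits either the inner anchor's value or the inner coefficients. In the latter
   case its degree, the sum of [e] over the first block plus 1, meets the prefactor with that sum as
   exponent, and only the minus sign remains. *)
have leibniz i r : (0 < i < n)%N -> r \in words [:: i; (n - i)%N] ->
    (-1) ^ (inv_deg e r + \sum_(j <- take i r) e j) *:
      rho_ext R (pts (take i r)) (rho_ext R (pts (drop i r)) b) =
    (-1) ^ (inv_deg d r + \sum_(j <- take i r) d j) *: (signed_prod * rho2 i r)
    - \sum_(j <- drop i r)
      (-1) ^ (inv_deg e r + e j * \sum_(h <- take (index j (drop i r)) (drop i r)) e h) *:
      rho_ext R (rho_ext R (pts (take i r)) (a j) ⊗ x j :: pts (rem j (drop i r))) b.
  move=> iP rw; have sr := words_size rw; have [st sd] := sz i r iP sr.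
  have rE := words_perm rw.
  have ud : uniq (drop i r) by rewrite drop_uniq // (perm_uniq rE) enum_uniq.
  have hD := rho_ext_derivation R ha hx st.
  rewrite (rho_ext_pure R ha hx (drop i r)) (linear_funZ (rho_ext_linear R _)).
  rewrite (derivation_leibniz hD _ (homog_prod ha _)) scalerDr.
  have := koszul_ext_leibniz ha hx 1 hD (rho_theta_multilinear R b)
    (rho_theta_symmetric R b) ud.
  rewrite {1}/rho_theta => ->.
  rewrite scalerDr addrC; congr (_ + _); last first.
    rewrite !scaler_sumr -sumrN; apply: eq_bigr => j _.
    by rewrite -signZ !scalerA; congr (_ *: _); parity.
  rewrite (rho_ext_pure R ha hx (take i r)) -/(rho2 i r) -!scalerAr mulrA.
  rewrite (gc_comm (homog_prod ha _) (homog_prod ha _)) -big_cat cat_take_drop -scalerAl.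
  rewrite -[in RHS]signzD [in RHS]mulrC -[in RHS]scalerA [(-1) ^ inv_deg d r *: _]scalerAl.
  rewrite -reorder_signed_prod // -!scalerAl !scalerA; congr (_ *: _).
  rewrite -[in ext_deg p d 0 r](cat_take_drop i r) ext_deg_cat !ext_degD !ext_deg1.
  rewrite !big_split /=; parity.
have bound F H : (forall i, (0 < i < n)%N -> F i = H i) ->
    \sum_(1 <= i < n) F i = \sum_(1 <= i < n) H i :> A.
  by move=> FH; rewrite !big_nat; apply: eq_bigr => i /FH.
rewrite (bound _ _ moved) [X in _ + X + _](_ : _ = \sum_(1 <= i < n)
    (\sum_(r <- words [:: i; (n - i)%N])
       (-1) ^ (inv_deg d r + \sum_(j <- take i r) d j) *: (signed_prod * rho2 i r)
     - \sum_(r <- words [:: i; (n - i)%N]) \sum_(j <- drop i r)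
        (-1) ^ (inv_deg e r + e j * \sum_(h <- take (index j (drop i r)) (drop i r)) e h) *:
        rho_ext R (rho_ext R (pts (take i r)) (a j) ⊗ x j :: pts (rem j (drop i r))) b));
  last first.
  apply: bound => i iP; rewrite -sumrB; apply: eq_big_seq => r rw.
  exact: leibniz.
(* The differentiated coefficients cancel against the third sum; what is left is [signed_prod] times
   the action identity. *)
rewrite sumrB -addrA subrK.
have act := rho_action R b n0 hx.
have R0 : R [seq x i | i : 'I_n] 0 = 0.
  exact: linear_fun0 (derivation_linear (rho_derivation R n0 hx)).
move: act; rewrite /= R0 scaler0 subr0 addr0 => act.
apply: etrans (etrans (congr1 (GRing.mul signed_prod) act) (mulr0 _)).
rewrite mulrDr; congr (_ + _).
  rewrite mulr_sumr !big_nat; apply: eq_bigr => i /andP[i0 iN].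
  have sb : sumn [:: i; (n - i)%N] = n by rewrite /= addn0 subnKC.
  rewrite (sum_shuffles_koszul d x (fun xs => R (l (take i xs) :: drop i xs) b) sb).
  rewrite mulr_sumr; apply: eq_big_seq => r /words_perm rE.
  rewrite (koszul_ext_bracket (rho_theta_multilinear R b)) ?i0 //.
  by rewrite map_take map_drop scalerAr.
rewrite mulr_sumr !big_nat; apply: eq_bigr => i /andP[i0 iN].
have sb : sumn [:: i; (n - i)%N] = n by rewrite /= addn0 subnKC // ltnW.
rewrite mulr_sumr -(sum_shuffles (fun r => (-1) ^ (inv_deg d r + \sum_(j <- take i r) d j) *:
  (signed_prod * rho2 i r)) sb); apply: eq_bigr => s _.
have sw : size (word s) = n by rewrite size_map size_enum_ord.
have [st sd] : (0 < size (take i (word s)))%N /\ (0 < size (drop i (word s)))%N.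
  by apply: sz; rewrite ?i0.
rewrite -scalerAr map_word koszul_word sum_take_word signzD /rho2 -map_take -map_drop.
by case: (take i _) st => // j1 r1 _; case: (drop i _) sd.
Qed.

End PureRelations.

(** * The relation on families of pure tensors *)

Section PostLieRelation.
Variables (k : fieldType) (A : algType k) (GA : gcalgebra A).
Variables (g : lmodType k) (G : grading g) (l : linfty G).
Variable (R : linfty_action l (zero_differential GA)).
Local Notation T := (tensor A g).
Local Notation GT := (tensor_grading GA G).
Local Notation plie := (plie R).

(** A copy of the left-hand side in [postlie_relation], isolated so that its multilinearity in both
    families can be stated. *)
Definition postlie_lhs n m (d : 'I_n -> int) (e : 'I_m -> int)
    (x : 'I_n -> T) (y : 'I_m -> T) : T :=
  \sum_(0 <= j < n) \sum_(1 <= i < (n - j).+1)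
    \sum_(s in shuffles n [:: j; i; (n - j - i)%N])
    koszul k d s *:
      (let xs := [seq x (s h) | h : 'I_n] in
       let ys := [seq y h | h : 'I_m] in
       plie (plie (take j xs) (take i (drop j xs)) :: drop (j + i) xs)
         ys)
  + \sum_(0 <= j < n.+1) \sum_(s in shuffles n [:: (n - j)%N; j])
    \sum_(1 <= i < m.+1) \sum_(t in shuffles m [:: i; (m - i)%N])
    (koszul k d s * koszul k e t
       * (-1) ^ (\sum_(h < n | (h < n - j)%N) d (s h))) *:
      (let xs := [seq x (s h) | h : 'I_n] in
       let ys := [seq y (t h) | h : 'I_m] in
       plie (take (n - j) xs)
         (plie (drop (n - j) xs) (take i ys) :: drop i ys)).

Lemma postlie_lhs_words n m (d : 'I_n -> int) (e : 'I_m -> int) x y :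
  postlie_lhs d e x y =
  \sum_(0 <= j < n) \sum_(1 <= i < (n - j).+1)
    \sum_(r <- shuffle_words n [:: j; i; (n - j - i)%N])
    (-1) ^ inv_deg d r *:
       plie (plie (map x (take j r)) (map x (take i (drop j r)))
               :: map x (drop (j + i) r)) (map y (enum 'I_m))
  + \sum_(0 <= i < n.+1) \sum_(r <- shuffle_words n [:: i; (n - i)%N])
    \sum_(1 <= h < m.+1) \sum_(t <- shuffle_words m [:: h; (m - h)%N])
    (-1) ^ (inv_deg d r + inv_deg e t + \sum_(j <- take i r) d j) *:
      plie (map x (take i r))
        (plie (map x (drop i r)) (map y (take h t)) :: map y (drop h t)).
Proof.
congr (_ + _).
  rewrite !big_nat; apply: eq_bigr => j jn; rewrite !big_nat; apply: eq_bigr => i iP.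
  have sb : sumn [:: j; i; (n - j - i)%N] = n by rewrite /=; lia.
  rewrite (sum_shuffles_koszul d x (fun xs =>
    plie (plie (take j xs) (take i (drop j xs)) :: drop (j + i) xs)
         [seq y h | h : 'I_m]) sb).
  by apply: eq_bigr => r _; rewrite !map_take !map_drop.
(* Reversing the sum makes [i] the size of the outer block, as in [rho_ext_action]. *)
rewrite big_nat_rev /= add0n !big_nat; apply: eq_bigr => i iP.
have -> : (n - (n.+1 - i.+1) = i)%N by lia.
have -> : (n.+1 - i.+1 = n - i)%N by lia.
have sb : sumn [:: i; (n - i)%N] = n by rewrite /=; lia.
rewrite -(sum_shuffles (fun r => \sum_(1 <= h < m.+1)
    \sum_(t <- shuffle_words m [:: h; (m - h)%N])
    (-1) ^ (inv_deg d r + inv_deg e t + \sum_(j <- take i r) d j) *: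
      plie (map x (take i r))
        (plie (map x (drop i r)) (map y (take h t)) :: map y (drop h t))) sb).
apply: eq_bigr => s _; rewrite !big_nat; apply: eq_bigr => h hP.
have sb' : sumn [:: h; (m - h)%N] = m by rewrite /=; lia.
rewrite -(sum_shuffles (fun t =>
    (-1) ^ (inv_deg d (word s) + inv_deg e t + \sum_(j <- take i (word s)) d j) *:
      plie (map x (take i (word s)))
        (plie (map x (drop i (word s))) (map y (take h t)) :: map y (drop h t))) sb').
apply: eq_bigr => t _.
by rewrite !map_word !koszul_word sum_take_word !signzD !map_take !map_drop.
Qed.

Lemma plie_cons0 xs ys : plie (0 :: xs) ys = 0.
Proof.
have := @plie_multilinearl _ _ _ _ _ _ R ys [::] xs (-1) 0 0.
by rewrite scaler0 addr0 scaleN1r addNr.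
Qed.

Lemma plie_0cons xs ys : plie xs (0 :: ys) = 0.
Proof.
have := @plie_multilinearr _ _ _ _ _ _ R xs [::] ys (-1) 0 0.
by rewrite scaler0 addr0 scaleN1r addNr.
Qed.

Section PureFamilies.
Variables (n m : nat) (n0 : (0 < n)%N) (m0 : (0 < m)%N).
Variables (p d : 'I_n -> int) (a : 'I_n -> A) (x : 'I_n -> g).
Variables (q f : 'I_m -> int) (c : 'I_m -> A) (z : 'I_m -> g).
Hypotheses (ha : forall i, homog GA (p i) (a i)) (hx : forall i, homog G (d i) (x i)).
Hypotheses (hc : forall i, homog GA (q i) (c i)) (hz : forall i, homog G (f i) (z i)).
Local Notation X := (fun i => a i ⊗ x i).
Local Notation Y := (fun i => c i ⊗ z i).
Local Notation e := (fun i => p i + d i).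
Local Notation e' := (fun i => q i + f i).
Local Notation summand i r := (\sum_(1 <= h < m.+1)
  \sum_(t <- shuffle_words m [:: h; (m - h)%N])
    (-1) ^ (inv_deg e r + inv_deg e' t + \sum_(j <- take i r) e j) *:
      plie (map X (take i r))
        (plie (map X (drop i r)) (map Y (take h t)) :: map Y (drop h t))).

(** Both ends reduce to the extended anchor of all the [X] applied to the bracket of all the [Y]. At
    [i = 0] it acts inside the bracket as a derivation and, being moved out past an operation of
    degree 1, acquires one extra sign. *)
Lemma postlie_ends :
  \sum_(r <- shuffle_words n [:: 0; (n - 0)%N]) summand 0%N r
  + \sum_(r <- shuffle_words n [:: n; (n - n)%N]) summand n r = 0.
Proof.
rewrite subn0 subnn shuffle_words_0n shuffle_words_n0 !big_seq1.
have sX : (0 < size (map X (enum 'I_n)))%N by rewrite size_map size_enum_ord.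
have sn : size (enum 'I_n) = n by rewrite size_enum_ord.
have sE : (0 < size (enum 'I_n))%N by rewrite sn.
have D := rho_ext_derivation R ha hx sE.
have -> : summand 0%N (enum 'I_n) =
    (-1) ^ (\sum_(j <- enum 'I_n) e j + 1) *:
      tens_map (rho_ext R (map X (enum 'I_n))) (bracket_ext GA l (map Y (enum 'I_m))).
  (* The inner operation has a nonempty first slot, so only [h = 1] survives. *)
  rewrite big_ltn // [X in _ + X]big_nat [X in _ + X]big1 ?addr0; last first.
    move=> h /andP[h1 hm]; apply: big1_seq => t /= /words_size st.
    rewrite drop0 [Z in Z :: _]plie0 ?plie_0cons ?scaler0 //.
    by rewrite size_map size_takel ?st.
  rewrite -(bracket_ext_derivation l hc hz D m0); apply: eq_big_seq => t /words_size st.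
  rewrite take0 drop0 big_nil addr0 (inv_deg_sorted _ (sorted_enum_ord n)) add0r.
  congr (_ *: _); case: t st => [|j t] st /=; first by move: m0; rewrite -st.
  by rewrite take0 drop0 /= plie_rho.
have -> : summand n (enum 'I_n) =
    (-1) ^ (\sum_(j <- enum 'I_n) e j) *:
      tens_map (rho_ext R (map X (enum 'I_n))) (bracket_ext GA l (map Y (enum 'I_m))).
  (* Here the outer operation has a nonempty first slot, so only [h = m] survives. *)
  rewrite big_nat_recr //= big_nat big1 ?add0r; last first.
    move=> h /andP[h1 hm]; apply: big1_seq => t /= /words_size st.
    rewrite plie0 ?scaler0 // ?size_map ?size_takel ?sn //=.
    by rewrite size_map size_drop st ltnS subn_gt0.
  rewrite subnn shuffle_words_n0 big_seq1 take_oversize ?sn // drop_oversize ?sn //.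
  rewrite take_oversize ?size_enum_ord // drop_oversize ?size_enum_ord //.
  by rewrite !(inv_deg_sorted _ (sorted_enum_ord _)) !add0r /= plie_rho.
by rewrite -scalerDl -signzNr addNr scale0r.
Qed.

Lemma words_take_drop i r : (0 < i < n)%N -> size r = n ->
  (0 < size (map X (take i r)))%N /\ (0 < size (map X (drop i r)))%N.
Proof.
by move=> /andP[i0 iN] sr; rewrite !size_map size_takel ?size_drop sr ?subn_gt0 // ltnW.
Qed.

Lemma postlie_lhs_pure_gt1 : (1 < m)%N -> postlie_lhs e e' X Y = 0.
Proof.
move=> m1; rewrite postlie_lhs_words [Z in _ + Z]big_nat_recr //.
rewrite [Z in _ + (Z + _)]big_ltn // [Z in _ + Z]addrAC postlie_ends add0r !big_nat [Z in Z + _]big1 ?add0r => [|j jn]; last first.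
  rewrite big_nat big1 // => i iP; rewrite big1 // => r _.
  by rewrite plie0 ?scaler0 // size_map size_enum_ord.
apply: big1 => i iP; apply: big1_seq => r /= /words_size sr; have [st sd] := words_take_drop iP sr.
rewrite big_nat big1 // => h /andP[h1 hm]; apply: big1_seq => t /= /words_size tm.
(* Both first slots are nonempty: the outer operation would need [h = m] and the inner one [h = 1],
   impossible for [m > 1]. *)
have [hlt|hge] := ltnP h m.
  by rewrite plie0 ?scaler0 // -[size _]/(size (map Y _)).+1 size_map size_drop tm ltnS subn_gt0.
rewrite [Z in Z :: _]plie0 ?plie_0cons ?scaler0 // size_map size_takel ?tm //.
exact: leq_trans m1 hge.
Qed.

End PureFamilies.

Lemma postlie_lhs_pure1 n (n0 : (0 < n)%N)
    (p d : 'I_n -> int) (a : 'I_n -> A) (x : 'I_n -> g)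
    (q f : 'I_1 -> int) (c : 'I_1 -> A) (z : 'I_1 -> g) :
    (forall i, homog GA (p i) (a i)) -> (forall i, homog G (d i) (x i)) ->
    (forall i, homog GA (q i) (c i)) -> (forall i, homog G (f i) (z i)) ->
  postlie_lhs (fun i => p i + d i) (fun i => q i + f i)
    (fun i => a i ⊗ x i) (fun i => c i ⊗ z i) = 0.
Proof.
move=> ha hx hc hz; rewrite postlie_lhs_words [Z in _ + Z]big_nat_recr //.
rewrite [Z in _ + (Z + _)]big_ltn // [Z in _ + Z]addrAC.
rewrite (postlie_ends n0 (isT : (0 < 1)%N) ha hx hc hz) add0r.
have zl : linear (fun u : A => u ⊗ z ord0) := tens_linearl (z ord0).
rewrite [Z in Z + _]big_ltn //.
have enum1 : enum 'I_1 = [:: ord0] by rewrite enum_ordSl enum_ord0.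
rewrite -[RHS](linear_fun0 zl) -(rho_ext_action R ha hx (c ord0) n0).
(* The terms match in turn: [j = 0] gives the brackets, [j > 0] the nested anchors, and the interior
   of the second sum the compositions. *)
rewrite !(linear_funD zl) [in RHS]addrAC; congr (_ + _ + _).
- rewrite subn0 (linear_fun_sum zl) !big_nat; apply: eq_bigr => i /andP[i0 iN].
  rewrite shuffle_words_0cons (linear_fun_sum zl); apply: eq_bigr => r _.
  rewrite (linear_funZ zl) take0 drop0 add0n enum1 plie_rho //.
  by rewrite tens_mapE //; exact: rho_ext_linear.
- rewrite (linear_fun_sum zl) !big_nat; apply: eq_bigr => j jP.
  rewrite (linear_fun_sum zl) big_ltn ?ltnS ?subn_gt0; last by case/andP: jP.
  (* With [j > 0] the inner operation is nonzero only for a single letter in its second slot. *)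
  rewrite [Z in _ + Z]big_nat [Z in _ + Z]big1 ?addr0; last first.
    move=> i /andP[i1 iN]; apply: big1_seq => r /= /words_size sr.
    have [st sd] := words_take_drop a x jP sr.
    rewrite [Z in Z :: _]plie0 ?plie_cons0 ?scaler0 //.
    by rewrite size_map size_takel // size_drop sr.
  apply: eq_big_seq => r /words_size sr; rewrite (linear_funZ zl) addn1; congr (_ *: _).
  have [st sd] := words_take_drop a x jP sr.
  rewrite enum1 plie_rho //; move: sd; case: (drop j r) => // i r' _ /=.
  rewrite take0 /= plie_rho // tens_mapE //; exact: rho_ext_linear.
rewrite (linear_fun_sum zl) !big_nat; apply: eq_bigr => i iP.
rewrite (linear_fun_sum zl); apply: eq_big_seq => r /words_size sr.
have [st sd] := words_take_drop a x iP sr.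
rewrite big_nat1 subnn shuffle_words_n0 big_seq1 (inv_deg_sorted _ (sorted_enum_ord 1)).
rewrite addr0 enum1 /= !plie_rho //.
rewrite (linear_funZ zl) !tens_mapE; try exact: rho_ext_linear.
by [].
Qed.

Lemma postlie_lhs_pure0 m (d : 'I_0 -> int) (X : 'I_0 -> T)
    (q f : 'I_m -> int) (c : 'I_m -> A) (z : 'I_m -> g) : (0 < m)%N ->
    (forall i, homog GA (q i) (c i)) -> (forall i, homog G (f i) (z i)) ->
  postlie_lhs d (fun i => q i + f i) X (fun i => c i ⊗ z i) = 0.
Proof.
move=> m0 hc hz; rewrite postlie_lhs_words big_geq // add0r big_nat1 subnn.
rewrite shuffle_words_n0 big_seq1 enum_ord0.
apply: etrans (bracket_ext_jacobi l hc hz m0).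
apply: eq_bigr => h _; apply: eq_bigr => t _.
by rewrite /= big_nil addr0 add0r.
Qed.

End PostLieRelation.

Lemma big_ord_enum (V : Type) (idx : V) (op : V -> V -> V) n (F : 'I_n -> V) :
  \big[op/idx]_(i < n) F i = \big[op/idx]_(i <- enum 'I_n) F i.
Proof. by rewrite [index_enum _]unlock -enumT. Qed.

(** * Multilinearity of the relation and the resulting structure *)

Section PostLieStructure.
Variables (k : fieldType) (A : algType k) (GA : gcalgebra A).
Variables (g : lmodType k) (G : grading g) (l : linfty G).
Variable (R : linfty_action l (zero_differential GA)).
Local Notation T := (tensor A g).
Local Notation GT := (tensor_grading GA G).
Local Notation plie := (plie R).

Lemma multilinear_fam_perm (V W : lmodType k) n (F : seq V -> W) (s : 'S_n) :
  multilinear F -> multilinear_fam (fun x => F [seq x (s h) | h : 'I_n]).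
Proof.
move=> mF x i c u v; rewrite !map_word; apply: (multilinear_fam_word mF).
by rewrite -mem_permutations -(perm_mem (perm_words n)) map_f ?mem_index_enum.
Qed.

Lemma plie_nested_multilinearl j i ys : multilinear (fun xs =>
  plie (plie (take j xs) (take i (drop j xs)) :: drop (j + i) xs) ys).
Proof.
have mB : multilinear (fun us => plie (take j us) (drop j us)).
  apply: (multilinear_take_drop (B := plie)) => us.
    exact: plie_multilinearl.
  exact: plie_multilinearr.
have := multilinear_take_drop (B := fun us vs => plie (plie (take j us) (drop j us) :: vs) ys)
  (j + i) _ _.
move=> mul s1 s2 c x y.
(* The three consecutive blocks are read as a split at [j + i] whose first half is split again at
   [j], so that the two-block lemma applies twice. *)
have drop_take (xs : seq T) : take i (drop j xs) = drop j (take (j + i) xs).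
  by rewrite addnC take_drop.
rewrite !drop_take -![take j (_ ++ _)](take_takel _ (leq_addr i j)); apply: mul.
  move=> vs; apply: (multilinear_cons (F := plie^~ ys)) => //; exact: plie_multilinearl.
move=> us; apply: (multilinear_cons_tail (F := plie^~ ys)); exact: plie_multilinearl.
Qed.

Lemma plie_nested_multilinearm j us ys : multilinear (fun xs =>
  plie (take j xs) (plie (drop j xs) us :: ys)).
Proof.
apply: (multilinear_take_drop (B := fun vs ws => plie vs (plie ws us :: ys))) => vs.
  exact: plie_multilinearl.
apply: (multilinear_cons (F := plie vs)); first exact: plie_multilinearr.
exact: plie_multilinearl.
Qed.

Lemma plie_nested_multilinearr i us vs : multilinear (fun ys =>
  plie us (plie vs (take i ys) :: drop i ys)).
Proof.
apply: (multilinear_take_drop (B := fun ws ys => plie us (plie vs ws :: ys))) => ys.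
  apply: (multilinear_cons (F := plie us)); exact: plie_multilinearr.
apply: (multilinear_cons_tail (F := plie us)); exact: plie_multilinearr.
Qed.

Lemma postlie_lhs_multilinearl n m (d : 'I_n -> int) (e : 'I_m -> int) y :
  multilinear_fam (fun x => postlie_lhs R d e x y).
Proof.
apply: multilinear_famD.
  do 3 (apply: multilinear_fam_sum => ?); apply: multilinear_famZ.
  apply: (multilinear_fam_perm (F := fun xs => plie (plie (take _ xs)
    (take _ (drop _ xs)) :: drop _ xs) _)).
  exact: plie_nested_multilinearl.
do 4 (apply: multilinear_fam_sum => ?); apply: multilinear_famZ.
apply: (multilinear_fam_perm (F := fun xs => plie (take _ xs) (plie (drop _ xs) _ :: _))).
exact: plie_nested_multilinearm.
Qed.

Lemma postlie_lhs_multilinearr n m (d : 'I_n -> int) (e : 'I_m -> int) x :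
  multilinear_fam (postlie_lhs R d e x).
Proof.
apply: multilinear_famD.
  do 3 (apply: multilinear_fam_sum => ?); apply: multilinear_famZ.
  apply: (multilinear_fam_word (F := plie _)) => //; exact: plie_multilinearr.
do 4 (apply: multilinear_fam_sum => ?); apply: multilinear_famZ.
apply: (multilinear_fam_perm (F := fun ys => plie _ (plie _ (take _ ys) :: drop _ ys))).
exact: plie_nested_multilinearr.
Qed.

Lemma pure_family n (D : 'I_n -> int) (X : 'I_n -> T) :
    (forall i, pure_homog GA G (D i) (X i)) ->
  exists p d a x, [/\ forall i, homog GA (p i) (a i), forall i, homog G (d i) (x i),
    D = (fun i => p i + d i) & X = (fun i => a i ⊗ x i)].
Proof.
move=> /choice[p] /choice[d] /choice[a] /choice[x h]; exists p, d, a, x.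
split=> [i|i||]; try by have [] := h i.
  by apply/funext => i; have [_ _ ->] := h i.
by apply/funext => i; have [_ _ _] := h i.
Qed.

(** The predicate is left general because the same reduction serves the vanishing of the relation
    and the degree of the operations. *)
Lemma pure_induction (P : T -> Prop) n m (d : 'I_n -> int) (e : 'I_m -> int)
    (f : ('I_n -> T) -> ('I_m -> T) -> T) :
    P 0 -> (forall c u v, P u -> P v -> P (c *: u + v)) ->
    (forall y, multilinear_fam (f^~ y)) -> (forall x, multilinear_fam (f x)) ->
    (forall x y, (forall i, pure_homog GA G (d i) (x i)) ->
       (forall i, pure_homog GA G (e i) (y i)) -> P (f x y)) ->
  forall x y, homogs GT d x -> homogs GT e y -> P (f x y).
Proof.
move=> P0 PP ml mr h x y hx hy.
apply: (@multilinear_fam_span _ _ _ _ P (f^~ y) (fun i => pure_homog GA G (d i))) => //.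
  move=> {hx}x hx.
  apply: (@multilinear_fam_span _ _ _ _ P (f x) (fun i => pure_homog GA G (e i))) => //.
    by move=> y' hy'; exact: h.
  by move=> i; exact: tensor_homog_lin_span (hy i).
by move=> i; exact: tensor_homog_lin_span (hx i).
Qed.

Lemma postlie_lhs0 n m (d : 'I_n -> int) (e : 'I_m -> int) x y : (0 < m)%N ->
  homogs GT d x -> homogs GT e y -> postlie_lhs R d e x y = 0.
Proof.
move=> m0; apply: (pure_induction (P := fun w => w = 0)) => //.
- by move=> c u v -> ->; rewrite scaler0 addr0.
- exact: postlie_lhs_multilinearl.
- exact: postlie_lhs_multilinearr.
move=> {}x {}y /pure_family[p [d' [a [x' [ha hx -> ->]]]]].
move=> /pure_family[q [f [c [z [hc hz -> ->]]]]].
have [n0|n0] := posnP n.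
  by subst n; exact: postlie_lhs_pure0.
have [m1|m1] := ltnP 1 m; first exact: postlie_lhs_pure_gt1.
have m1E : m = 1%N by apply/eqP; rewrite eqn_leq m1.
by subst m; exact: postlie_lhs_pure1.
Qed.

Lemma plie_degree n m (d : 'I_n -> int) (e : 'I_m -> int)
    (x : 'I_n -> T) (y : 'I_m -> T) : (0 < m)%N ->
  homogs GT d x -> homogs GT e y ->
  homog GT (\sum_(i < n) d i + \sum_(i < m) e i + 1)
    (plie [seq x i | i : 'I_n] [seq y i | i : 'I_m]).
Proof.
move=> m0; apply: (pure_induction (f := fun x y => plie [seq x i | i : 'I_n] [seq y i | i : 'I_m])).
- exact: homog0.
- by move=> c u v; exact: homogP.
- move=> {}y; apply: (multilinear_fam_word (F := plie^~ _)) => //; exact: plie_multilinearl.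
- move=> {}x; apply: (multilinear_fam_word (F := plie _)) => //; exact: plie_multilinearr.
move=> {}x {}y /pure_family[p [d' [a [x' [ha hx -> ->]]]]].
move=> /pure_family[q [f [c [z [hc hz -> ->]]]]].
rewrite !big_ord_enum.
have [n0|n0] := posnP n.
  subst n; rewrite /image_mem enum_ord0 big_nil add0r.
  rewrite -[plie _ _]/(bracket_ext GA l _) (bracket_ext_pure l hc hz); apply: homogZ.
  have me : (0 < size (enum 'I_m))%N by rewrite size_enum_ord.
  apply: TensorHomogTens (homog_prod hc _) (bracket_degree_seq l me hz) _.
  by rewrite big_split /= addrA.
have [m1|m1] := ltnP 1 m.
  by rewrite plie0 ?size_image ?card_ord //; exact: (homog0 GT).
have m1E : m = 1%N by apply/eqP; rewrite eqn_leq m1.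
subst m; have enum1 : enum 'I_1 = [:: ord0] by rewrite enum_ordSl enum_ord0.
have nE : (0 < size (enum 'I_n))%N by rewrite size_enum_ord.
rewrite [Z in plie _ Z]/image_mem enum1 /= plie_rho ?size_image ?card_ord //.
rewrite tens_mapE; last exact: rho_ext_linear.
apply: TensorHomogTens (hz ord0) _.
  exact: (derivation_degree (rho_ext_derivation R ha hx nE) (hc ord0)).
by rewrite big_seq1; ring.
Qed.

Definition tensor_postlie : postlie_infty GT :=
  PostLieInfty (fun ys _ => plie_multilinearl R ys) (plie_multilinearr R)
    (fun ys _ => plie_symmetricl R ys) (plie_symmetricr R) plie_degree postlie_lhs0.

End PostLieStructure.

Theorem corollary4p18 (k : fieldType) (char0 : [pchar k] =i pred0)
    (A : algType k) (GA : gcalgebra A) (g : lmodType k) (G : grading g)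
    (E : linfty_algebroid GA G) :
  exists M : postlie_infty (tensor_grading GA G),
    [/\ forall q (p d : 'I_q -> int) (a : 'I_q -> A) (x : 'I_q -> g),
          (0 < q)%N -> homogs GA p a -> homogs G d x ->
          M [::] [seq a i ⊗ x i | i : 'I_q] =
            tensor_sign k p d *:
              ((\prod_(i < q) a i) ⊗ bracket E [seq x i | i : 'I_q]),
        forall n (p d : 'I_n -> int) (a : 'I_n -> A) (x : 'I_n -> g)
            (b : A) (y : g),
          (0 < n)%N -> homogs GA p a -> homogs G d x ->
          M [seq a i ⊗ x i | i : 'I_n] [:: b ⊗ y] =
            tensor_sign k p d *:
              ((\prod_(i < n) a i * anchor E [seq x i | i : 'I_n] b) ⊗ y)
      & forall xs ys : seq (tensor A g),
          (0 < size xs)%N -> (1 < size ys)%N -> M xs ys = 0].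
Proof.
pose R := anchor E.
exists (tensor_postlie R); split.
- move=> q p d a x _ ha hx.
  rewrite tensor_sign_enum big_ord_enum.
  exact: bracket_ext_pure ha hx _.
- move=> n p d a x b y n0 ha hx.
  have nE : (0 < size (enum 'I_n))%N by rewrite size_enum_ord.
  rewrite tensor_sign_enum big_ord_enum.
  rewrite [LHS]/= plie_rho ?size_image ?card_ord // tens_mapE; last exact: rho_ext_linear.
  rewrite (rho_ext_pure R ha hx) tensZl; congr (_ *: (_ * _ ⊗ _)).
  (* On the nonempty list of letters [rho0] agrees with the anchor. *)
  by rewrite /image_mem; case: (enum 'I_n) nE.
- exact: plie0.
Qed.
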